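(* The homogeneous Bethe subalgebra $\mathcal{A}^S_n\subset\mathbb{C}[\mathfrak{S}_n]$ is generated by the elements $G^{[n]}_2,\dots,G^{[n]}_n$. More precisely, $$T^{[n]}(u,v)=\hat{\mathcal{P}}(u,v;S^{[n]}_1).$$
   Context: $\mathfrak{S}_n$ is the symmetric group; $\sigma_{a,b}$ is the transposition of $a$ and $b$; permutations are multiplied as functions (right factor acts first). $A^{[m]}=\frac1{m!}\sum_{\sigma\in\mathfrak{S}_m}\mathrm{sign}(\sigma)\,\sigma$. We view $\mathfrak{S}_n\subset\mathfrak{S}_{n+m}$ as the permutations fixing $n+1,\dots,n+m$, and $\vartheta_m:\mathbb{C}[\mathfrak{S}_m]\to\mathbb{C}[\mathfrak{S}_{n+m}]$ is the embedding induced by $i\mapsto n+i$. For $p\in\mathbb{C}$ the linear map $\mathrm{Tr}^{(p)}_m:\mathbb{C}[\mathfrak{S}_{n+m}]\to\mathbb{C}[\mathfrak{S}_n]$ is defined as follows: for $\sigma\in\mathfrak{S}_{n+m}$ written as a product of disjoint cycles, delete all symbols $>n$ and read the result as $\tau\in\mathfrak{S}_n$; let $c(\sigma)$, $c(\tau)$ be the numbers of orbits of $\sigma$ on $\{1,\dots,n+m\}$ and of $\tau$ on $\{1,\dots,n\}$; then $\mathrm{Tr}^{(p)}_m(\sigma)=p^{c(\sigma)-c(\tau)}\tau$ (with $p^0=1$). It is applied coefficientwise to polynomials in $u$. Put (parameters $\hbar=1$, $z_1=\dots=z_n=0$) $T^{[n]}_0(u;p)=u^n$ and, for $m\ge1$,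 $$T^{[n]}_m(u;p)=\mathrm{Tr}^{(p)}_m\Bigl(\vartheta_m(A^{[m]})\bigl(u+\sum_{i=1}^m\sigma_{n,n+i}\bigr)\cdots\bigl(u+\sum_{i=1}^m\sigma_{1,n+i}\bigr)\Bigr)=\sum_{i=0}^nT^{[n]}_{m,i}(p)u^{n-i}.$$ $\mathcal{A}^S_n$ is the unital subalgebra of $\mathbb{C}[\mathfrak{S}_n]$ generated by all $T^{[n]}_{m,i}(p)$, $m=1,\dots,n-1$, $i=1,\dots,n$, for a given $p$; it is commutative and does not depend on $p$. Set $T^{[n]}(u,v)=\sum_{m=0}^n(-1)^mT^{[n]}_m(u;n)v^{n-m}$. Set $G^{[n]}_k=\sum_{1\le i_1<\dots<i_k\le n}\sigma_{i_1,i_2}\sigma_{i_2,i_3}\cdots\sigma_{i_{k-1},i_k}$ for $k=2,\dots,n$, and $S^{[n]}_1(u)=n\,u^{n-1}+\sum_{k=2}^nG^{[n]}_k\,u^{n-k}$. For a polynomial $q(u)$, let $\hat Z$, $\hat Q$ be the $n\times n$ matrices with entries $\hat Z_{ab}=\delta_{a,b-1}$ and $$\hat Q_{ab}=\frac1{(n-a)!}\,\frac{d^{\,n-a}}{du^{\,n-a}}\Bigl(\frac{q(u)}{(u+1)^b}\Bigr)\Big|_{u=0},$$ and put $\hat{\mathcal{P}}(u,v;q)=\det\bigl((u-\hat Z)(v-\hat Q)-\hat Q\bigr)$, which depends polynomially on the coefficients of $q$. $\hat{\mathcal{P}}(u,v;S^{[n]}_1)$ means substituting for the coefficients of $q$ the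 (commuting) coefficients of $S^{[n]}_1(u)$. *)

(* Defs.v *)
From HB Require Import structures.
From mathcomp Require Import all_boot all_order all_algebra all_fingroup all_field.

Set Implicit Arguments.
Unset Strict Implicit.
Unset Printing Implicit Defensive.

Import GRing.Theory.
Local Open Scope ring_scope.

(* The symbols 1, ..., n of the mathematics are the elements 0, ..., n - 1 of  *)
(* 'I_n, and the symbols n + 1, ..., n + m are the rshift n i, i : 'I_m.       *)

(* F[S_n], as functions on the permutations with convolution product.  In 'S_n *)
(* the product (s * t)%g applies s first; in the group algebra permutations    *)
(* are composed as functions, the right factor acting first (see sgenM).       *)
Definition symalg (F : fieldType) (n : nat) : Type := {ffun 'S_n -> F^o}.

HB.instance Definition _ (F : fieldType) n :=
  Vector.copy (symalg F n) {ffun 'S_n -> F^o}.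

Section SymAlg.
Variables (F : fieldType) (n : nat).
Implicit Types (x y z : symalg F n) (s t : 'S_n).

Definition sgen s : symalg F n := [ffun t => (t == s)%:R].

Definition symalg_one : symalg F n := sgen 1%g.
Definition symalg_mul x y : symalg F n :=
  [ffun s => \sum_(t : 'S_n) (x t : F) * y (s * t^-1)%g].

Fact symalg_mulA : associative symalg_mul.
Proof.
move=> x y z; apply/ffunP=> s; rewrite !ffunE.
under eq_bigr => t _ do rewrite ffunE big_distrr /=.
rewrite exchange_big /=.
rewrite [RHS](eq_bigr (fun r => \sum_t (x t : F) * y (r * t^-1)%g * z (s * r^-1)%g)).
  rewrite [RHS]exchange_big [LHS]exchange_big /=; apply: eq_bigr => t _.
  rewrite [RHS](reindex_inj (mulIg t)) /=; apply: eq_bigr => r _.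
  by rewrite mulgK invMg !mulgA mulrA.
by move=> r _; rewrite ffunE big_distrl.
Qed.

Fact symalg_mul1x : left_id symalg_one symalg_mul.
Proof.
move=> x; apply/ffunP=> s; rewrite !ffunE (bigD1 1%g) //= big1 => [|t /negPf nt].
  by rewrite ffunE eqxx mul1r invg1 mulg1 addr0.
by rewrite ffunE nt mul0r.
Qed.

Fact symalg_mulx1 : right_id symalg_one symalg_mul.
Proof.
move=> x; apply/ffunP=> s; rewrite !ffunE (bigD1 s) //= big1 => [|t /negPf nt].
  by rewrite ffunE mulgV eqxx mulr1 addr0.
rewrite ffunE -(inj_eq (mulIg t)) mulgKV mul1g eq_sym nt.
by rewrite mulr0.
Qed.

Fact symalg_mulDl : left_distributive symalg_mul +%R.
Proof.
move=> x y z; apply/ffunP=> s; rewrite !ffunE -big_split /=.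
by apply: eq_bigr => t _; rewrite ffunE mulrDl.
Qed.

Fact symalg_mulDr : right_distributive symalg_mul +%R.
Proof.
move=> x y z; apply/ffunP=> s; rewrite !ffunE -big_split /=.
by apply: eq_bigr => t _; rewrite ffunE mulrDr.
Qed.

Fact symalg_one_neq0 : symalg_one != 0.
Proof.
apply/eqP => /ffunP/(_ 1%g); rewrite !ffunE eqxx => /eqP.
by rewrite oner_eq0.
Qed.

HB.instance Definition _ := GRing.Zmodule_isNzRing.Build (symalg F n)
  symalg_mulA symalg_mul1x symalg_mulx1 symalg_mulDl symalg_mulDr
  symalg_one_neq0.

Fact symalg_scaleAl (a : F) x y : a *: (x * y) = (a *: x) * y.
Proof.
apply/ffunP=> s; rewrite !ffunE scaler_sumr.
by apply: eq_bigr => t _; rewrite ffunE; exact: mulrA.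
Qed.

HB.instance Definition _ :=
  GRing.LSemiModule_isLSemiAlgebra.Build F (symalg F n) symalg_scaleAl.

Fact symalg_scaleAr (a : F) x y : a *: (x * y) = x * (a *: y).
Proof.
apply/ffunP=> s; rewrite !ffunE scaler_sumr.
by apply: eq_bigr => t _; rewrite ffunE; exact: mulrCA.
Qed.

HB.instance Definition _ :=
  GRing.Lalgebra_isAlgebra.Build F (symalg F n) symalg_scaleAr.

HB.instance Definition _ := Algebra_isFalgebra.Build F (symalg F n).

Lemma sgenM s t : sgen s * sgen t = sgen (t * s)%g.
Proof.
apply/ffunP=> r; rewrite !ffunE (bigD1 s) //= big1 => [|q /negPf nq].
  by rewrite !ffunE eqxx mul1r addr0 -(inj_eq (mulIg s)) mulgKV.
by rewrite ffunE nq mul0r.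
Qed.

End SymAlg.

Section ShiftPerm.
Variables (n m : nat) (s : 'S_m).

Definition shift_fun (x : 'I_(n + m)) : 'I_(n + m) :=
  match split x with inl j => lshift m j | inr k => rshift n (s k) end.

Fact shift_fun_inj : injective shift_fun.
Proof.
move=> x y; rewrite /shift_fun.
case: (split_ordP x) => j ->; case: (split_ordP y) => k ->.
- by [].
- by move/eqP; rewrite eq_lrshift.
- by move/eqP; rewrite eq_rlshift.
- by move=> /rshift_inj/perm_inj->.
Qed.

Definition shift_perm : 'S_(n + m) := perm shift_fun_inj.

End ShiftPerm.

Section DelPerm.
Variables (n m : nat) (s : 'S_(n + m)).

Definition lshift_inv (x : 'I_(n + m)) : option 'I_n :=
  match split x with inl j => Some j | inr _ => None end.

(* orbit s x is the cycle [:: x; s x; ...] of s, and next reads off the        *)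
(* successor in the cycle from which the symbols rshift n k have been deleted. *)
Definition del_cycle (j : 'I_n) : seq 'I_n :=
  pmap lshift_inv (fingraph.orbit s (lshift m j)).
Definition del_fun (j : 'I_n) : 'I_n := next (del_cycle j) j.

Fact lshift_invK : ocancel lshift_inv (lshift m).
Proof. by move=> x; rewrite /lshift_inv; case: (split_ordP x) => j ->. Qed.

Fact lshiftK : pcancel (lshift m) lshift_inv.
Proof.
move=> j; rewrite /lshift_inv; case: (split_ordP (lshift m j)) => k => [/lshift_inj->//|].
by move/eqP; rewrite eq_lrshift.
Qed.

Fact mem_del_cycle i j : (i \in del_cycle j) = (lshift m i \in fingraph.orbit s (lshift m j)).
Proof. exact: can2_mem_pmap lshift_invK lshiftK _ _. Qed.

Fact del_cycle_uniq j : uniq (del_cycle j).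
Proof. by apply: (pmap_uniq lshift_invK); apply: orbit_uniq. Qed.

Fact next_del_cycle i j :
  i \in del_cycle j -> next (del_cycle i) =1 next (del_cycle j).
Proof.
rewrite mem_del_cycle => ij k.
have [r ->] : {r | del_cycle i = rot r (del_cycle j)}.
  have [r Dr] := orbit_rot_cycle (cycle_orbit (@perm_inj _ s) _)
                   (orbit_uniq s _) ij.
  rewrite /del_cycle Dr -{2}[fingraph.orbit s (lshift m j)](cat_take_drop r).
  rewrite pmap_cat /rot pmap_cat; exists (size (pmap lshift_inv (take r (fingraph.orbit s (lshift m j))))).
  by rewrite drop_size_cat // take_size_cat.
by rewrite next_rot // del_cycle_uniq.
Qed.

Fact del_fun_inj : injective del_fun.
Proof.
move=> i j eij.
have self k : k \in del_cycle k by rewrite mem_del_cycle in_orbit.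
have mem k : del_fun k \in del_cycle k by rewrite mem_next.
have ij : i \in del_cycle j.
  have := mem j; have := mem i; rewrite eij !mem_del_cycle -!fconnect_orbit.
  move=> ci cj; apply: connect_trans cj _.
  by rewrite fconnect_sym //; apply: perm_inj.
move: eij; rewrite /del_fun (next_del_cycle ij).
exact: (can_inj (prev_next (del_cycle_uniq j))).
Qed.

Definition del_perm : 'S_n := perm del_fun_inj.

End DelPerm.

Section Bethe.
Variable F : fieldType.

(* Here (-1) ^+ s is the sign of the permutation s. *)
Definition antisym m : symalg F m :=
  m`!%:R^-1 *: \sum_(s : 'S_m) (-1) ^+ s *: sgen F s.

Definition vartheta n m (x : symalg F m) : symalg F (n + m) :=
  \sum_(s : 'S_m) x s *: sgen F (shift_perm n s).

Definition Tr n m (p : F) (x : symalg F (n + m)) : symalg F n :=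
  \sum_(s : 'S_(n + m))
    (x s * p ^+ (#|porbits s| - #|porbits (del_perm s)|)) *: sgen F (del_perm s).

(* The factors are ordered from the symbol n (left) to the symbol 1 (right). *)
Definition Tpoly n m (p : F) : {poly symalg F n} :=
  if m == 0%N then 'X^n else
  map_poly (@Tr n m p)
    ((vartheta n (antisym m))%:P *
     \prod_(j < n)
       ('X + (\sum_(i < m) sgen F (tperm (lshift m (rev_ord j)) (rshift n i)))%:P)).

Definition Tcoef n m i (p : F) : symalg F n := (Tpoly n m p)`_(n - i).

Definition bethe_alg n (p : F) : {vspace symalg F n} :=
  agenv <<[seq Tcoef n m i p | m <- iota 1 n.-1, i <- iota 1 n]>>%VS.

(* In {poly {poly _}} the inner variable is u and the outer one is v. *)
Definition Tuv n : {poly {poly symalg F n}} :=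
  \sum_(m < n.+1) ((-1) ^+ m * Tpoly n m n%:R)%:P * 'X^(n - m).

(* zip t (behead t) lists the pairs of consecutive entries of t. *)
Definition Gsum n k : symalg F n :=
  \sum_(t : k.-tuple 'I_n | sorted ltn (map val t))
    \prod_(ab <- zip t (behead t)) sgen F (tperm ab.1 ab.2).

Definition S1 n : {poly symalg F n} :=
  'X^(n.-1) *+ n + \sum_(2 <= k < n.+1) Gsum n k *: 'X^(n - k).

End Bethe.

(* The determinant Phat n q is defined by the Leibniz formula for q over any   *)
(* F-algebra A: A = F gives the numerical polynomial.  Every entry is affine   *)
(* in the coefficients of q, and Phat n commutes with algebra morphisms        *)
(* (Phat_map), so that for q with pairwise commuting coefficients Phat n q is  *)
(* the generic Phat with these coefficients substituted for those of q.        *)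
Section SpectralPolynomial.
Variables (F : fieldType) (A : algType F).

(* The pair (f, b) stands for the rational function f / (u + 1)^b, and the     *)
(* quotient rule reads (f / (u + 1)^b)' = (f' (u + 1) - b f) / (u + 1)^(b + 1). *)
Definition qderiv (fb : {poly A} * nat) : {poly A} * nat :=
  (fb.1^`() * ('X + 1) - fb.1 *+ fb.2, fb.2.+1).

(* The denominator (u + 1)^b equals 1 at u = 0. *)
Definition Qhat_entry (q : {poly A}) (k b : nat) : A :=
  k`!%:R^-1 *: (iter k qderiv (q, b)).1.[0].

Definition Zhat n : 'M[{poly {poly A}}]_n :=
  \matrix_(a < n, b < n) (a.+1 == b)%:R.

(* Row and column a of the mathematics have index a - 1. *)
Definition Qhat n (q : {poly A}) : 'M[{poly {poly A}}]_n :=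
  \matrix_(a < n, b < n) (Qhat_entry q (n - a.+1) b.+1)%:P%:P.

Definition Phat n (q : {poly A}) : {poly {poly A}} :=
  \det (('X%:P%:M - Zhat n) *m ('X%:M - Qhat n q) - Qhat n q).

End SpectralPolynomial.

Lemma Phat_map (F : fieldType) (A B : algType F) (f : {lrmorphism A -> B}) n
    (q : {poly A}) :
  map_poly (map_poly f) (Phat n q) = Phat n (map_poly f q).
Proof.
have itE k b : (iter k (@qderiv F B) (map_poly f q, b)) =
    (map_poly f (iter k (@qderiv F A) (q, b)).1, (iter k (@qderiv F A) (q, b)).2).
  elim: k => //= k ->; rewrite /qderiv /=; congr (_, _).
  by rewrite deriv_map rmorphB rmorphMn rmorphM rmorphD rmorph1 /= map_polyX.
rewrite /Phat /determinant rmorph_sum; apply: eq_bigr => s _.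
rewrite rmorphM rmorph_sign rmorph_prod; congr (_ * _); apply: eq_bigr => i _.
have QE (a b : 'I_n) : map_poly (map_poly f) (Qhat n q a b) =
    Qhat n (map_poly f q) a b.
  rewrite !mxE !map_polyC /= map_polyC /= /Qhat_entry itE linearZ /=.
  by rewrite !horner_coef0 coef_map.
rewrite !mxE rmorphB rmorph_sum /=.
have := QE i (s i); rewrite !mxE => ->; congr (_ - _).
apply: eq_bigr => j _; rewrite rmorphM !mxE !rmorphB !rmorphMn !rmorph1 /=.
by have := QE j (s i); rewrite !mxE => ->; rewrite map_polyC /= !map_polyX.
Qed.

(* Main.v *)
Require Import Defs.
From mathcomp Require Import all_boot all_order all_algebra all_fingroup all_field.
From mathcomp Require Import reals.
From mathcomp.real_closed Require Import complex.
From HB Require Import structures.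
From mathcomp Require Import ring zify.

Set Implicit Arguments.
Unset Strict Implicit.
Unset Printing Implicit Defensive.

Import GRing.Theory Num.Theory.
Local Open Scope ring_scope.

(** Write T_m(u) for the transfer matrix with m auxiliary symbols and parameter
    p, q(u) for S_1(u), and t_m for the coefficient of u^n in T_m.

    Everything follows from one recursion ([Tpoly_fusion]):
      (u - 1)^n T_(m+1)(u) = T_m(u - 1) T_1(u)   modulo u^n.
    The right-hand side is the trace over m + 1 auxiliary symbols 0, ..., m of
    A Y_n ... Y_1, where A is the antisymmetrizer of 1, ..., m and
    Y_j = (u - 1 + s_(j,1) + ... + s_(j,m)) (u + s_(j,0)).  Let A' be the
    antisymmetrizer of 0, ..., m.  Then A' Y_j = (u - 1) A' (u + sum_i s_(j,i)),
    so A' contributes the left-hand side, whereas Y_j (A - A') is a multiple of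
    u, so by cyclicity of the trace A - A' contributes a multiple of u^n
    ([transfer_fusion]).  The same decomposition yields recursions in m for the
    two highest coefficients of T_m ([Tpoly_top_rec], [Tpoly_sub_rec]).

    Since T_1 = p u^n + S_1 ([Tpoly1E]), the recursion puts all coefficients of
    all T_m in the algebra generated by those of S_1, for every p, and T_1
    itself gives the converse inclusion; this is the first assertion.  That
    algebra is commutative by the Yang-Baxter equation ([Tpoly1_comm]).

    For the second assertion, work in this commutative algebra.  Dividing the
    recursion by (u - 1)^n shows that the vector w_m of the lower coefficients
    of T_m satisfies w_(m+1) = - K w_m + t_m q, where K = M C^T for the Hankel
    matrix M of q and a matrix C of signed binomial coefficients, while the
    matrix in the spectral polynomial is Qhat = M C.  With the shift matrix Z,
    Pascal's rule gives the rank one relation K = Z K - K Z + q e1.  Although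
    the T_m depend on p, the matrix K does not, and two values of p are used.
    - For p = 0 the t_m with m > 0 vanish, so w_(m+1) = (-K)^m q, and the known
      second coefficients of the T_m say e1 K^m q = n.  By the rank one relation
      all powers of K have trace n, so K has the characteristic polynomial
      (v - 1)^n ([lax_mx_char_poly]).
    - For p = n, sum_m (-1)^m t_m v^(n-m) = (v - 1)^n as well, and by
      Cayley-Hamilton W = sum_m (-1)^m w_m v^(n-m) solves
      (v - K) W = - (v - 1)^n q.  The rank one relation then turns the
      determinant of v (u - Z) - (u - Z + 1) K into a companion determinant with
      the value sum_m (-1)^m T_m(u) v^(n-m) ([Phat_fusion]).
    Finally, transposing and conjugating by (u - Z + 1) M replaces K by Qhat in
    this determinant ([det_swap]); M is invertible because its determinant is up
    to sign a power of the constant coefficient of S_1, which is a permutation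
    ([S1_coef0]).

    The trace itself is handled one deleted symbol at a time: deleting x is
    linear over the permutations that fix x on either side, which makes it a
    conditional expectation, and different deletions commute.  Iterating gives
    the trace of the statement ([push_Tr]). *)

(** * Polynomials modulo a power of X *)

Section Truncation.
Variable R : nzRingType.
Implicit Types (f g h : {poly R}) (n b : nat).

Definition eqmodX n f g := forall i, (i < n)%N -> f`_i = g`_i.

Lemma eqmodX_trans n f g h : eqmodX n f g -> eqmodX n g h -> eqmodX n f h.
Proof. by move=> fg gh i lt_in; rewrite fg ?gh. Qed.

Lemma eqmodXM n f f' g g' :
  eqmodX n f f' -> eqmodX n g g' -> eqmodX n (f * g) (f' * g').
Proof.
move=> ff gg i lt_in; rewrite !coefM; apply: eq_bigr => j _.
by rewrite ff ?gg //; have := ltn_ord j; lia.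
Qed.

Lemma eqmodXD n f f' g g' :
  eqmodX n f f' -> eqmodX n g g' -> eqmodX n (f + g) (f' + g').
Proof. by move=> ff gg i lt_in; rewrite !coefD ff ?gg. Qed.

Lemma eqmodX_Xn n f : eqmodX n ('X^n * f) 0.
Proof. by move=> i lt_in; rewrite coefXnM lt_in coef0. Qed.

(** The truncated expansion of (X + 1)^-(b + 1). *)
Definition binom_series n b : {poly R} :=
  \poly_(a < n) ((-1) ^+ a *+ 'C(a + b, a)).

Lemma binom_seriesP n b : eqmodX n (('X + 1) ^+ b.+1 * binom_series n b) 1.
Proof.
elim: b => [|b IHb] i lt_in.
  rewrite expr1 mulrDl mul1r coefD coefXM !coef_poly coef1 lt_in.
  case: i lt_in => [|i] lt_in; first by rewrite add0r.
  by rewrite (ltnW lt_in) !addn0 !binn exprS mulN1r /= addrN.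
rewrite exprSr -mulrA; move: i lt_in; apply: eqmodX_trans (IHb).
apply: eqmodXM => // i lt_in.
rewrite mulrDl mul1r coefD coefXM !coef_poly lt_in.
case: i lt_in => [|i] lt_in; first by rewrite !bin0 add0r.
rewrite (ltnW lt_in) exprS mulN1r [i.+1.-1]/=.
rewrite addSn binS addSnnS mulrnDr !mulNrn.
by rewrite [i.+1 == _]/= addrC subrK.
Qed.

(** The truncated expansion of (X - 1)^-(b + 1). *)
Definition binom_series_opp n b : {poly R} :=
  \poly_(a < n) (- ((-1) ^+ b *+ 'C(a + b, a))).

Lemma binom_series_oppP n b :
  eqmodX n (('X - 1) ^+ b.+1 * binom_series_opp n b) 1.
Proof.
elim: b => [|b IHb] i lt_in.
  rewrite expr1 mulrBl mul1r coefB coefXM !coef_poly coef1 lt_in.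
  case: i lt_in => [|i] lt_in; first by rewrite sub0r opprK.
  by rewrite (ltnW lt_in) !addn0 !binn /= subrr.
rewrite exprSr -mulrA; move: i lt_in; apply: eqmodX_trans (IHb).
apply: eqmodXM => // i lt_in.
rewrite mulrBl mul1r coefB coefXM !coef_poly lt_in.
case: i lt_in => [|i] lt_in; first by rewrite !bin0 sub0r exprS mulN1r !mulr1n !opprK.
rewrite (ltnW lt_in) exprS mulN1r [i.+1.-1]/=.
rewrite addSn binS addSnnS mulrnDr !mulNrn !opprK.
by rewrite [i.+1 == _]/= addrC subrK.
Qed.

End Truncation.

Section QuotientRule.
Variables (F : fieldType) (A : comAlgType F).
Implicit Types (f g q : {poly A}).

(** Evaluating f / (X + 1)^b at 0 only sees f modulo a power of X; if f agrees
    with (X + 1)^b g there, the quotient rule agrees with differentiating g. *)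
Lemma qderiv_series k N b f g :
    (k < N)%N -> eqmodX N f (('X + 1) ^+ b * g) ->
  (iter k (@qderiv F A) (f, b)).1.[0] = g^`(k).[0].
Proof.
elim: k N b f g => [|k IHk] [|N] b f g // lt_kN fg.
  have -> : (iter 0 (@qderiv F A) (f, b)).1 = f by [].
  rewrite derivn0 !horner_coef0 fg // -!horner_coef0 hornerM.
  by rewrite horner_exp hornerD hornerX hornerC add0r expr1n mul1r.
rewrite iterSr derivSn {}(IHk N _ _ g^`()) // => i lt_iN.
pose h := ('X + 1) ^+ b * g.
have -> : (('X + 1) ^+ b.+1 * g^`()) = h^`() * ('X + 1) - h *+ b.
  rewrite /h derivM deriv_exp derivD derivX derivC addr0 mul1r.
  rewrite mulrDl mulrnAl mulrnAl [_ * g * _]mulrAC [_ * g^`() * _]mulrAC -!exprSr.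
  case: b {fg h} => [|b]; first by rewrite !mulr0n subr0 add0r.
  by rewrite [b.+1.-1]/= addrAC subrr add0r.
rewrite /= !coefB !coefMn; congr (_ - _ *+ _); last by apply/fg/ltnW.
by apply: (@eqmodXM _ N) => // j lt_jN; rewrite !coef_deriv fg.
Qed.

Lemma Qhat_entryE (charA : forall k, k`!%:R != 0 :> F) n q k b :
  (k < n)%N -> Qhat_entry q k b.+1 = (q * binom_series A n b)`_k.
Proof.
move=> lt_kn; rewrite /Qhat_entry (@qderiv_series k n _ _ (q * binom_series A n b)) //.
  rewrite horner_coef0 coef_derivn addn0 ffactnn -scaler_nat scalerA.
  by rewrite mulVf ?scale1r.
rewrite mulrCA => i lt_in; rewrite -[q in LHS]mulr1.
by symmetry; move: i lt_in; apply: eqmodXM => //; apply: binom_seriesP.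
Qed.

End QuotientRule.

(** * The matrices M, C, Z and K *)

Section Hankel.
Variables (R : comNzRingType) (n : nat).
Implicit Types q s : {poly R}.

(** The coefficient of X^-(k + 1) in q / X^n. *)
Definition hankel_coef q k : R := if (k < n)%N then q`_(n.-1 - k) else 0.
Definition hankel q : 'M[R]_n := \matrix_(a, b) hankel_coef q (a + b).
Definition binom_mx : 'M[R]_n := \matrix_(a, b) ((-1) ^+ a *+ 'C(a + b, a)).
Definition shift_mx : 'M[R]_n := \matrix_(a, b) (a.+1 == b)%:R.
Definition e1 : 'rV[R]_n := \row_b (b == 0%N :> nat)%:R.
Definition qcol q : 'cV[R]_n := \col_a hankel_coef q a.

(** Entry (a, b) is the coefficient of X^(n - 1 - a) in - q / (X - 1)^(b + 1);
    without the transposition it would be the one in q / (X + 1)^(b + 1). *)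
Definition lax_mx q := hankel q *m binom_mx^T.

Lemma sum_pick (k : nat) (f : nat -> R) :
  \sum_(c < n) (k == c :> nat)%:R * f c = if (k < n)%N then f k else 0.
Proof.
have [lt_kn|ge_kn] := ltnP k n; last first.
  by apply: big1 => c _; rewrite (_ : (k == c :> nat) = false) ?mul0r //; have := ltn_ord c; lia.
rewrite (bigD1 (Ordinal lt_kn)) //= eqxx mul1r big1 ?addr0 // => c /negPf nc.
by rewrite eq_sym; move: nc; rewrite -val_eqE /= => ->; rewrite mul0r.
Qed.

Lemma hankel_tr q : (hankel q)^T = hankel q.
Proof. by apply/matrixP => a b; rewrite !mxE addnC. Qed.

(** Entries of a Hankel matrix depend on a + b only, and those with a + b >= n
    vanish, so no boundary term appears. *)
Lemma hankel_shift q : hankel q *m shift_mx^T = shift_mx *m hankel q.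
Proof.
have sE a (b : nat) : \sum_(c < n) (a.+1 == c :> nat)%:R * hankel_coef q (c + b) =
    hankel_coef q (a.+1 + b).
  rewrite (sum_pick _ (fun c => hankel_coef q (c + b))).
  by case: ifP => // ge_an; rewrite /hankel_coef; case: ifP => //; lia.
apply/matrixP => a b; rewrite !mxE.
under [LHS]eq_bigr => c _ do rewrite !mxE mulrC addnC.
under [RHS]eq_bigr => c _ do rewrite !mxE.
by rewrite !sE addSnnS addnC.
Qed.

Lemma hankel_e1 q : hankel q *m e1^T = qcol q.
Proof.
apply/matrixP => a b; rewrite !mxE.
under eq_bigr => c _ do rewrite !mxE mulrC eq_sym.
rewrite (sum_pick _ (fun c => hankel_coef q (a + c))) addn0.
by case: ifP => //; have := ltn_ord a; lia.
Qed.

(** Entrywise this is Pascal's rule. *)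
Lemma binom_mx_shift :
  shift_mx^T *m binom_mx - binom_mx *m shift_mx + binom_mx = e1^T *m e1.
Proof.
apply/matrixP => a b; rewrite !mxE big_ord1 !mxE.
have -> : \sum_(c < n) shift_mx^T a c * binom_mx c b =
    if a == 0%N :> nat then 0 else (-1) ^+ a.-1 *+ 'C(a.-1 + b, a.-1).
  case: a => -[|a] lt_an /=.
    by apply: big1 => c _; rewrite !mxE mul0r.
  under eq_bigr => c _ do rewrite !mxE /= eqSS eq_sym.
  by rewrite (sum_pick _ (fun c => (-1) ^+ c *+ 'C(c + b, c))) ltnW.
have -> : \sum_(c < n) binom_mx a c * shift_mx c b =
    if b == 0%N :> nat then 0 else (-1) ^+ a *+ 'C(a + b.-1, a).
  case: b => -[|b] lt_bn /=.
    by apply: big1 => c _; rewrite !mxE mulr0.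
  under eq_bigr => c _ do rewrite !mxE /= eqSS mulrC eq_sym.
  by rewrite (sum_pick _ (fun c => (-1) ^+ a *+ 'C(a + c, a))) ltnW.
case: a b => -[|a] lt_an [[|b] lt_bn] /=.
- by rewrite !bin0 subrr add0r mulr1.
- by rewrite !bin0 sub0r addNr mulr0.
- by rewrite subr0 !addn0 !binn exprS mulN1r addrN mul0r.
- rewrite mul0r (_ : 'C(a.+1 + b.+1, a.+1) = 'C(a.+1 + b, a.+1) + 'C(a + b.+1, a))%N.
    move: 'C(a.+1 + b, a.+1) 'C(a + b.+1, a) => k l.
    by rewrite mulrnDr addrA subrK exprS mulN1r mulNrn addrN.
  by rewrite addnS binS addSnnS.
Qed.

(** M Z^T = Z M moves the shift through the Hankel factor, so this is
    [binom_mx_shift] transposed and multiplied by M. *)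
Lemma lax_mx_shift q :
  lax_mx q = shift_mx *m lax_mx q - lax_mx q *m shift_mx + qcol q *m e1.
Proof.
have := congr1 (fun B => hankel q *m B^T) binom_mx_shift.
rewrite !linearD !linearN /= !trmx_mul !trmxK !mulmxA hankel_e1 hankel_shift.
rewrite -!/(lax_mx q) -[shift_mx *m hankel q *m _]mulmxA -/(lax_mx q) => <-.
by rewrite !addrA subrK addrN add0r.
Qed.

Lemma coef_hankel q (s : nat -> R) (a : 'I_n) :
  (q * \poly_(c < n) s c)`_(n.-1 - a) = \sum_(c < n) hankel_coef q (a + c) * s c.
Proof.
rewrite coefMr.
rewrite (big_ord_widen n (fun j => q`_(n.-1 - a - j) * (\poly_(c < n) s c)`_j));
  last by have := ltn_ord a; lia.
rewrite [LHS]big_mkcond /=; apply: eq_bigr => c _.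
rewrite coef_poly ltn_ord /hankel_coef.
have := ltn_ord a; have := ltn_ord c => lt_c lt_a.
have -> : (c < (n.-1 - a).+1)%N = (a + c < n)%N by lia.
by case: ifP => // _; rewrite ?mul0r // subnDA.
Qed.

End Hankel.
Arguments binom_mx {R n}.
Arguments shift_mx {R n}.
Arguments e1 {R n}.

(** * Determinants *)

Section Determinants.
Variables (R : comNzRingType) (n : nat).
Implicit Types (u v c : R) (M C Z K E : 'M[R]_n).

(** Both sides are c times the determinant of the block matrix with rows
    (c, -w) and (y, 1), computed by eliminating either of its block columns. *)
Lemma det_rank1 c (w : 'cV[R]_n) (y : 'rV[R]_n) :
  c * \det (c%:M + w *m y) = c ^+ n * (c + (y *m w) 0 0).
Proof.
pose B : 'M_(n + 1) := block_mx c%:M (- w) y 1%:M.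
have detB : \det B = \det (c%:M + w *m y).
  have : B *m block_mx 1%:M 0 (- y) 1%:M = block_mx (c%:M + w *m y) (- w) 0 1%:M.
    rewrite mulmx_block !mulmx1 !mulmx0 !add0r mul1mx addrN.
    by rewrite mulmxN mulNmx opprK.
  move/(congr1 determinant); rewrite det_mulmx det_lblock det_ublock !det1.
  by rewrite !mulr1.
have : B *m block_mx 1%:M w 0 c%:M = block_mx c%:M 0 y (c%:M + y *m w).
  rewrite mulmx_block !mulmx1 !mulmx0 !addr0 mul1mx mulNmx mul_mx_scalar.
  by rewrite mul_scalar_mx addrN addrC.
move/(congr1 determinant); rewrite det_mulmx det_lblock det_ublock !det1.
rewrite !det_scalar mul1r expr1 detB mulrC => ->; congr (_ * _).
by rewrite det_mx11 !mxE eqxx mulr1n.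
Qed.

(** Transposition turns (X + 1) M C into C^T M (X^T + 1), and conjugation by
    (X + 1) M brings it back to the same shape with C replaced by C^T. *)
Lemma det_swap u v M C Z (X : 'M[R]_n := u%:M - Z) :
    M^T = M -> M *m Z^T = Z *m M ->
  \det ((X + 1%:M) *m M) * \det (v *: X - (X + 1%:M) *m (M *m C)) =
  \det (v *: X - (X + 1%:M) *m (M *m C^T)) * \det ((X + 1%:M) *m M).
Proof.
move=> symM MZ.
have MX : M *m X^T = X *m M.
  by rewrite /X linearB /= tr_scalar_mx mulmxBr mulmxBl MZ mul_mx_scalar mul_scalar_mx.
move: X MX => X MX.
rewrite -[\det (_ - _ *m (M *m C))]det_tr -!det_mulmx; congr determinant.
have -> : (v *: X - (X + 1%:M) *m (M *m C))^T = v *: X^T - C^T *m M *m (X^T + 1%:M).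
  by rewrite linearB linearZ /= !trmx_mul symM [(X + _)^T]linearD /= tr_scalar_mx.
rewrite mulmxBr mulmxBl -!scalemxAr -scalemxAl; congr (_ *: _ - _).
  by rewrite -mulmxA MX mulmxA [in RHS]mulmxA !mulmxDr !mulmxDl !mulmx1 !mul1mx.
rewrite -!mulmxA; congr (_ *m (_ *m (_ *m _))).
by rewrite !mulmxDr !mulmxDl !mulmx1 !mul1mx MX.
Qed.

Lemma rank_one_shift u v K Z E (X : 'M[R]_n := u%:M - Z) :
    K = Z *m K - K *m Z + E ->
  v *: X - (X + 1%:M) *m K = (v%:M - K) *m X - E.
Proof.
move=> KE; have XK : X *m K + K = K *m X + E.
  rewrite {2}KE /X mulmxBl mulmxBr mul_scalar_mx mul_mx_scalar.
  by rewrite !addrA subrK.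
move: X XK => X XK.
by rewrite mulmxDl mul1mx XK mulmxBl mul_scalar_mx opprD addrA.
Qed.

Lemma det_shift u : \det (u%:M - shift_mx : 'M[R]_n) = u ^+ n.
Proof.
rewrite -det_tr det_trig.
  under eq_bigr => i _ do rewrite !mxE eqxx gtn_eqF // subr0.
  by rewrite big_const_ord iter_mulr_1.
apply/is_trig_mxP => i j lt_ij; rewrite !mxE.
by rewrite -val_eqE /= gtn_eqF // gtn_eqF ?subr0 // ltnW.
Qed.

(** A companion determinant: with the row y = (u^(n - 1), ..., 1), u^n times the
    matrix is (c u^n + w y) (u - Z), and [det_rank1] applies to the first factor. *)
Lemma det_shift_e1 u c (w : 'cV[R]_n) : GRing.lreg u ->
  c * \det (c *: (u%:M - shift_mx) + w *m e1) =
  c ^+ n * (c * u ^+ n + \sum_(a < n) w a 0 * u ^+ (n.-1 - a)).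
Proof.
move=> reg_u; pose y : 'rV[R]_n := \row_b u ^+ (n.-1 - b).
have yX : y *m (u%:M - shift_mx) = u ^+ n *: e1.
  apply/rowP => b; rewrite mulmxBr mul_mx_scalar !mxE.
  have -> : \sum_(j < n) y 0 j * shift_mx j b =
      if b == 0%N :> nat then 0 else u ^+ (n.-1 - b.-1).
    case: b => -[|b] lt_bn /=; first by apply: big1 => j _; rewrite !mxE mulr0.
    under eq_bigr => j _ do rewrite !mxE /= eqSS mulrC eq_sym.
    by rewrite (sum_pick _ _ (fun j => u ^+ (n.-1 - j)%N)) ltnW.
  rewrite -exprS; case: b => -[|b] lt_bn /=.
    by rewrite subr0 mulr1 subn0 prednK.
  by rewrite mulr0 (_ : (n.-1 - b.+1).+1 = n.-1 - b)%N ?subrr //; lia.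
(* By yX, multiplication by u^n turns w e1 into w y X. *)
have := det_rank1 (c * u ^+ n) w y.
set D := \det (_ + w *m e1); move=> detD.
have : (u ^+ n) ^+ n * D = \det ((c * u ^+ n)%:M + w *m y) * u ^+ n.
  rewrite -detZ -[X in _ = _ * X](det_shift u) -det_mulmx; congr determinant.
  rewrite mulmxDl -mulmxA yX scalerDr scalerA mul_scalar_mx mulrC.
  by rewrite scalemxAr.
move=> eD.
have regun k : GRing.lreg (u ^+ k) by apply: lregX.
apply/(regun (n * n)%N)/(regun n).
rewrite mulrA [u ^+ (n * n)]exprM.
transitivity ((c * u ^+ n) * ((u ^+ n) ^+ n * D)); first by ring.
rewrite eD [LHS]mulrA detD exprMn.
have -> : (y *m w) 0 0 = \sum_(a < n) w a 0 * u ^+ (n.-1 - a).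
  by rewrite mxE; apply: eq_bigr => a _; rewrite mxE mulrC.
by ring.
Qed.

End Determinants.

(** * A trace criterion for the characteristic polynomial (X - 1)^n *)

Section CharPoly.
Variables (R : comNzRingType) (n : nat).
Implicit Types (A : 'M[R]_n).

Lemma deriv_det (B : 'M[{poly R}]_n) :
  (\det B)^`() = \sum_i \sum_j (B i j)^`() * cofactor B i j.
Proof.
have prodE (s : 'S_n) : (\prod_i B i (s i))^`() =
    \sum_i (B i (s i))^`() * \prod_(k | k != i) B k (s k).
  have : forall (r : seq 'I_n), uniq r -> (\prod_(i <- r) B i (s i))^`() =
      \sum_(i <- r) (B i (s i))^`() * \prod_(k <- r | k != i) B k (s k).
    elim=> [|a r IHr] /=; first by rewrite !big_nil derivC.
    case/andP=> ar /IHr {}IHr; rewrite !big_cons derivM IHr eqxx /=; congr (_ * _ + _).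
      rewrite big_seq [RHS]big_seq_cond; apply: eq_bigl => k.
      by case: (boolP (k \in r)) => //= kr; case: eqP kr ar => // -> ->.
    rewrite mulr_sumr; apply: eq_big_seq => i ir.
    rewrite big_cons; case: eqP ar ir => [->|_ _ _]; first by move/negP.
    by rewrite mulrCA.
  by apply; apply: index_enum_uniq.
pose D i : 'M_n := \matrix_(k, j) if k == i then (B i j)^`() else B k j.
have detD i : \det (D i) = \sum_j (B i j)^`() * cofactor B i j.
  rewrite (expand_det_row _ i); apply: eq_bigr => j _; rewrite mxE eqxx.
  congr (_ * (_ * \det _)); apply/matrixP => k l.
  by rewrite !mxE [_ == i]eq_sym (negPf (neq_lift _ _)).
under [RHS]eq_bigr => i _ do rewrite -detD.
rewrite [LHS]raddf_sum /= exchange_big /=; apply: eq_bigr => s _.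
have -> : ((-1) ^+ s * \prod_i B i (s i))^`() =
    (-1) ^+ s * (\prod_i B i (s i))^`().
  by rewrite -signr_odd; case: (odd s); rewrite ?mul1r // ?expr1 !mulN1r derivN.
rewrite prodE mulr_sumr; apply: eq_bigr => i _; congr (_ * _).
rewrite [RHS](bigD1 i) //= mxE eqxx; congr (_ * _); apply: eq_bigr => k /negPf ki.
by rewrite mxE ki.
Qed.

(** Jacobi's formula: all off-diagonal entries of X - A have derivative 0. *)
Lemma deriv_char_poly A : (char_poly A)^`() = \tr (\adj (char_poly_mx A)).
Proof.
rewrite deriv_det; apply: eq_bigr => i _; rewrite (bigD1 i) //= big1 ?addr0.
  by rewrite !mxE eqxx derivB derivC derivX subr0 mul1r.
move=> j /negPf ji; rewrite !mxE eq_sym ji mulr0n sub0r derivN derivC.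
by rewrite oppr0 mul0r.
Qed.

End CharPoly.

Section Unipotent.
Variables (R : comNzRingType) (n : nat).
Hypothesis natr_reg : forall k (x : R), x *+ k.+1 = 0 -> x = 0.
Implicit Types (A : 'M[R]_n).

(** The differential equation (X - 1) f' = n f has no solution of degree
    less than n, since there the leading coefficients do not match. *)
Lemma deriv_eq_Xsub1 (f : {poly R}) : f \is monic -> size f = n.+1 ->
  ('X - 1) * f^`() = f *+ n -> f = ('X - 1) ^+ n.
Proof.
move=> mon_f sz_f fE; apply/eqP; rewrite -subr_eq0; apply/eqP.
set g := _ - _.
have gE : ('X - 1) * g^`() = g *+ n.
  rewrite /g derivB mulrBr fE mulrnBl; congr (_ - _).
  rewrite deriv_exp derivB derivX -[1]/(1%:P) derivC subr0 mul1r.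
  case: (n) => [|k]; first by rewrite !mulr0n mulr0.
  by rewrite mulrnAr -exprS.
have mon_X : ('X - 1 : {poly R}) ^+ n \is monic by rewrite monic_exp ?monicXsubC.
have sz_g : (size g <= n)%N.
  have sz_X : size (('X - 1 : {poly R}) ^+ n) = n.+1.
    by rewrite size_exp_XsubC.
  apply/leq_sizeP => j; rewrite leq_eqVlt => /predU1P[<-|lt_nj]; last first.
    by rewrite coefB !nth_default ?subrr ?sz_f ?sz_X.
  have := monicP mon_f; have := monicP mon_X.
  by rewrite !lead_coefE sz_f sz_X /= coefB => -> ->; rewrite subrr.
case sz: (size g) => [|d]; first by apply/eqP; rewrite -size_poly_eq0 sz.
have lt_dn : (d < n)%N by rewrite -sz.
have : (('X - 1) * g^`())`_d = g`_d *+ n by rewrite gE coefMn.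
rewrite mulrBl mul1r coefB coefXM !coef_deriv [g`_d.+1]nth_default ?sz // mul0rn subr0.
have -> : (if d == 0 then 0 else g`_d.-1.+1 *+ d.-1.+1) = g`_d *+ d by case: (d).
rewrite -(subnK (ltnW lt_dn)) mulrnDr => /eqP.
rewrite -subr_eq0 opprD addrCA subrr addr0 oppr_eq0 -(subnSK lt_dn) => /eqP/natr_reg.
by move/eqP; rewrite -[d]/(d.+1.-1) -sz -lead_coefE lead_coef_eq0 => /eqP.
Qed.

End Unipotent.

Section UnipotentTrace.
Variables (R : comNzRingType) (n' : nat).
Local Notation n := n'.+1.
Hypothesis natr_reg : forall k (x : R), x *+ k.+1 = 0 -> x = 0.
Implicit Types (A : 'M[R]_n).

Lemma horner_mxE (S : comNzRingType) (B : 'M[S]_n) (p : {poly S}) :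
  horner_mx B p = \sum_(k < size p) p`_k *: B ^+ k.
Proof.
rewrite -{1}[p]coefK poly_def rmorph_sum; apply: eq_bigr => k _ /=.
by rewrite horner_mxZ rmorphXn /= horner_mx_X.
Qed.

(** With f the characteristic polynomial, Cayley-Hamilton makes the adjugate
    of X - A the divided difference of f at X and A, so that the trace
    condition gives \tr (A * adj) = \tr adj; by Jacobi's formula this is the
    differential equation (X - 1) f' = n f. *)
Lemma char_poly_trace1 A : (forall k, \tr (A ^+ k) = n%:R) ->
  char_poly A = ('X - 1) ^+ n.
Proof.
move=> trA; set f := char_poly A; pose A' := map_mx polyC A.
pose B := char_poly_mx A.
have BE : B = 'X%:M - A' by [].
have sz_f : size f = n.+1 by apply: size_char_poly.
have mon_f : f \is monic by apply: char_poly_monic.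
pose N k : 'M[{poly R}]_n := \sum_(i < k) 'X%:M ^+ (k.-1 - i) * A' ^+ i.
have adjB : \adj B = \sum_(k < size f) (f`_k)%:P *: N k.
  have BN : B *m (\sum_(k < size f) (f`_k)%:P *: N k) = f%:M.
    have : horner_mx A' (map_poly polyC f) = 0.
      by rewrite -map_horner_mx Cayley_Hamilton map_mx0.
    rewrite horner_mxE size_map_polyC => fA.
    have fX : \sum_(k < size f) (f`_k)%:P *: 'X%:M ^+ k = f%:M :> 'M_n.
      rewrite -[in RHS](coefK f) poly_def raddf_sum; apply: eq_bigr => k _ /=.
      by rewrite -rmorphXn /= scale_scalar_mx mul_polyC.
    rewrite -fX -[RHS]subr0 -[X in _ = _ - X]fA -sumrB mulmx_sumr.
    apply: eq_bigr => k _; rewrite coef_map /= -scalerBr -scalemxAr; congr (_ *: _).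
    by rewrite BE [RHS]subrXX_comm //; apply: comm_scalar_mx.
  have regf : GRing.lreg f by apply: monic_lreg.
  apply/matrixP => i j; apply: regf.
  have /matrixP/(_ i j) := congr1 (mulmx (\adj B)) BN.
  by rewrite mulmxA mul_adj_mx mul_scalar_mx mul_mx_scalar mxE [RHS]mxE.
have trAN k : \tr (A' *m N k) = \tr (N k).
  have trA' i : \tr (A' ^+ i) = n%:R.
    by rewrite -rmorphXn /= trace_map_mx trA rmorph_nat.
  rewrite mulmx_sumr !raddf_sum /=; apply: eq_bigr => i _.
  have -> : 'X%:M ^+ (k.-1 - i) * A' ^+ i = 'X^(k.-1 - i) *: A' ^+ i.
    by rewrite -rmorphXn /= [LHS]mul_scalar_mx.
  by rewrite -scalemxAr !linearZ /= -[A' *m _]/(A' * _) -exprS !trA'.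
have trAadj : \tr (A' *m \adj B) = \tr (\adj B).
  rewrite adjB mulmx_sumr !raddf_sum; apply: eq_bigr => k _ /=.
  by rewrite -scalemxAr !linearZ /= trAN.
apply: (deriv_eq_Xsub1 natr_reg) => //.
rewrite /f deriv_char_poly -/B mulrBl mul1r -[X in _ - X]trAadj.
rewrite -mxtraceZ -mul_scalar_mx -raddfB -mulmxBl -BE mul_mx_adj.
by rewrite /= mxtrace_scalar.
Qed.
End UnipotentTrace.

(** * The fusion recursion and the spectral polynomial *)

Section BetheFamily.
Variable R : comNzRingType.
Implicit Types (q : {poly R}) (T : nat -> {poly R}) (t : nat -> R).

(** What is used of the transfer matrices T_m: t_m is the coefficient of X^n,
    and q stands for the part of T_1 of degree less than n. *)
Record fusion_family n q t T : Prop := FusionFamily {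
  fusion_size : forall m, (size (T m) <= n.+1)%N;
  fusion_top : forall m, (T m)`_n = t m;
  fusion_step : forall m,
    eqmodX n (('X - 1) ^+ n * T m.+1) ((T m \Po ('X - 1)) * q) }.

(** Entry a is the coefficient of X^-(a + 1) in f / X^n. *)
Definition lower_coefs n (f : {poly R}) : 'cV[R]_n := \col_a f`_(n.-1 - a).

(** Each (X - 1)^(n - 1 - b) is (X - 1)^n times a [binom_series_opp] modulo X^n,
    and the common factor (X - 1)^n is invertible there. *)
Lemma fusion_rec n q t T m : fusion_family n q t T ->
  lower_coefs n (T m.+1) = - (lax_mx n q *m lower_coefs n (T m)) + t m *: qcol n q.
Proof.
case=> szT topT stepT; pose D : {poly R} := 'X - 1.
pose s b := binom_series_opp R n b.
pose w b := (T m)`_(n.-1 - b).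
have TD : T m \Po D = (t m)%:P * D ^+ n + \sum_(b < n) (w b)%:P * D ^+ (n.-1 - b).
  rewrite comp_polyE (big_ord_widen _ (fun i => (T m)`_i *: D ^+ i) (szT m)).
  rewrite big_mkcond big_ord_recr /= addrC; congr (_ + _).
    rewrite -topT mul_polyC; case: ifP => // /negbT; rewrite -leqNgt => le_n.
    by rewrite nth_default // scale0r.
  rewrite (reindex_inj rev_ord_inj) /=; apply: eq_bigr => b _.
  rewrite mul_polyC (_ : n - b.+1 = n.-1 - b)%N; last by have := ltn_ord b; lia.
  case: ifP => // /negbT; rewrite -leqNgt /w => le_n.
  by rewrite nth_default // scale0r.
have sD b : eqmodX n (D ^+ b.+1 * s b) 1 by apply: binom_series_oppP.
have sD' (b : 'I_n) : eqmodX n (D ^+ (n.-1 - b)) (D ^+ n * s b).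
  have -> : D ^+ n = D ^+ (n.-1 - b) * D ^+ b.+1.
    by rewrite -exprD; congr (_ ^+ _); have := ltn_ord b; lia.
  rewrite -mulrA => i lt_in; rewrite -[D ^+ _ in LHS]mulr1.
  by symmetry; move: i lt_in; apply: eqmodXM.
pose V := (t m)%:P * q + \sum_(b < n) (w b)%:P * (q * s b).
have VE (a : 'I_n) : (T m.+1)`_(n.-1 - a) = V`_(n.-1 - a).
  have DV : eqmodX n (D ^+ n * T m.+1) (D ^+ n * V).
    apply: eqmodX_trans (stepT m) _; rewrite TD mulrDl mulrDr.
    apply: eqmodXD; first by rewrite mulrA [D ^+ n * _]mulrC.
    rewrite mulr_suml mulr_sumr => i lt_in; rewrite !coef_sum.
    apply: eq_bigr => b _; rewrite -mulrA [D ^+ n * _]mulrCA !coefCM; congr (_ * _).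
    by rewrite [D ^+ n * _]mulrCA [D ^+ _ * q]mulrC; move: i lt_in; apply: eqmodXM.
  have D1 : eqmodX n (D ^+ n * s n.-1) 1.
    by case: (n) a (sD n.-1) => [[]|].
  have cancelD f : eqmodX n ((D ^+ n * s n.-1) * f) f.
    by rewrite -[X in eqmodX _ _ X]mul1r; apply: eqmodXM.
  have lt_a : (n.-1 - a < n)%N by have := ltn_ord a; lia.
  rewrite -cancelD // -[RHS]cancelD // ![D ^+ n * _]mulrC -!mulrA.
  by move: (_ - a)%N lt_a; apply: eqmodXM.
apply/colP => a; rewrite !mxE VE /V coefD coefCM coef_sum [LHS]addrC; congr (_ + _).
  rewrite -sumrN; apply: eq_bigr => b _; rewrite coefCM coef_hankel !mxE.
  rewrite mulrC -mulNr; congr (_ * _); rewrite -sumrN; apply: eq_bigr => c _.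
  rewrite !mxE mulrN addnC; congr (- (_ * (_ *+ _))).
  by rewrite addnC -bin_sub ?leq_addl // addnK addnC.
by rewrite /hankel_coef ltn_ord.
Qed.

Lemma lower_coefsXn n : lower_coefs n 'X^n = 0 :> 'cV[R]_n.
Proof.
apply/colP => a; rewrite !mxE coefXn (_ : (_ == _)%N = false) //.
by have := ltn_ord a; lia.
Qed.

End BetheFamily.

Section DetHankel.
Variables (R : comNzRingType) (n : nat).

(** Reversing the rows makes the Hankel matrix lower triangular, with constant
    diagonal. *)
Lemma det_hankel (q : {poly R}) : exists s, \det (hankel n q) = (-1) ^+ s * q`_0 ^+ n.
Proof.
pose s := perm (@rev_ord_inj n); exists (odd_perm s).
have : \det (row_perm s (hankel n q)) = q`_0 ^+ n.
  rewrite det_trig.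
    under eq_bigr => i _ do rewrite !mxE permE /= /hankel_coef.
    rewrite (eq_bigr (fun=> q`_0)) ?big_const_ord ?iter_mulr_1 // => i _.
    have lt_i := ltn_ord i; rewrite ifT; last by lia.
    by congr (q`__); lia.
  apply/is_trig_mxP => i j lt_ij; rewrite !mxE permE /= /hankel_coef.
  by have lt_i := ltn_ord i; case: ifP => //; lia.
rewrite row_permE det_mulmx det_perm => <-.
by rewrite mulrA -expr2 sqrr_sign mul1r.
Qed.

End DetHankel.

Section Spectral.
Variables (F : numFieldType) (A : comAlgType F) (n' : nat).
Local Notation n := n'.+1.
Variable q : {poly A}.

Lemma alg_mulrn_eq0 k (x : A) : x *+ k.+1 = 0 -> x = 0.
Proof.
rewrite -scaler_nat => /(congr1 ( *:%R k.+1%:R^-1)).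
by rewrite scalerA mulVf ?pnatr_eq0 // scale1r scaler0.
Qed.

Lemma e1_lower_coefs (f : {poly A}) : (e1 *m lower_coefs n f) 0 0 = f`_n'.
Proof.
rewrite mxE big_ord_recl big1 => [|i _]; last by rewrite !mxE mul0r.
by rewrite !mxE mul1r addr0 subn0.
Qed.

Local Notation K := (lax_mx n q).

(** For these t_m the recursion degenerates to powers of K, and by the rank one
    relation \tr K^(k+1) is e1 K^k q, a second coefficient up to sign. *)
Lemma lax_mx_char_poly (T : nat -> {poly A}) :
    fusion_family n q (fun m => (m == 0%N)%:R) T -> T 0%N = 'X^n ->
    (forall m, (T m.+1)`_n' = (-1) ^+ m *+ n) ->
  char_poly K = ('X - 1) ^+ n.
Proof.
move=> famT T0 subT; apply: char_poly_trace1 => [|k]; first exact: alg_mulrn_eq0.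
case: k => [|k]; first by rewrite expr0 mxtrace1.
have wT m : lower_coefs n (T m.+1) = (- K) ^+ m *m qcol n q.
  elim: m => [|m IHm]; rewrite (fusion_rec _ famT).
    by rewrite T0 lower_coefsXn mulmx0 oppr0 add0r scale1r expr0 mul1mx.
  by rewrite scale0r addr0 IHm mulmxA -mulNmx exprS -[in LHS]mulNmx.
have e1K : (e1 *m K ^+ k *m qcol n q) 0 0 = n%:R.
  have := e1_lower_coefs (T k.+1); rewrite subT wT [(- K) ^+ _]exprNn.
  rewrite -mulmxA => /(congr1 ( *%R ((-1) ^+ k))).
  rewrite mulrnAr -expr2 sqrr_sign => <-.
  have -> : (-1) ^+ k * K ^+ k = (-1) ^+ k *: K ^+ k.
    by rewrite -signr_odd mulr_sign -[in RHS]signr_odd scaler_sign.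
  by rewrite -scalemxAl -scalemxAr [in RHS]mxE mulrA -expr2 sqrr_sign mul1r.
have comm_tr : \tr (K ^+ k *m (shift_mx *m K)) = \tr (K ^+ k *m (K *m shift_mx)).
  rewrite [K ^+ k *m (K *m _)]mulmxA mulmxA mxtrace_mulC mulmxA.
  by rewrite -[K *m _]/(K * K ^+ k) -exprS exprSr.
have -> : K ^+ k.+1 = K ^+ k *m K by rewrite exprSr.
rewrite [X in _ *m X]lax_mx_shift mulmxDr mulmxBr mxtraceD raddfB /=.
by rewrite comm_tr subrr add0r mulmxA mxtrace_mulC mulmxA trace_mx11.
Qed.

End Spectral.

Section SpectralTheorem.
Variables (F : numFieldType) (A : comAlgType F) (n' : nat).
Local Notation n := n'.+1.
Variable q : {poly A}.
Local Notation K := (lax_mx n q).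
Local Notation P := {poly {poly A}}.
Let cc : {rmorphism A -> P} := GRing.RMorphism.clone _ _ (polyC \o polyC) _.
Local Notation "M ^cc" := (map_mx cc M) (at level 2).
Let u : P := 'X%:P.
Let v : P := 'X.
Let X : 'M[P]_n := u%:M - shift_mx.

Lemma PhatE : Phat n q = \det (v *: X - (X + 1%:M) *m ((hankel n q)^cc *m binom_mx)).
Proof.
have QE : Qhat n q = (hankel n q)^cc *m binom_mx.
  apply/matrixP => a b; rewrite !mxE (@Qhat_entryE _ _ _ n).
  - have lt_a := ltn_ord a; rewrite (_ : n - a.+1 = n.-1 - a)%N; last by lia.
    rewrite coef_hankel -[_%:P%:P]/(cc _) rmorph_sum; apply: eq_bigr => c _.
    by rewrite !mxE rmorphM rmorphMn rmorph_sign.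
  - by move=> k; rewrite pnatr_eq0 -lt0n fact_gt0.
  - by rewrite subSS ltnS leq_subr.
have ZE : Zhat A n = shift_mx by [].
have expand (Y M : 'M[P]_n) : Y *m (v%:M - M) - M = v *: Y - (Y + 1%:M) *m M.
  by rewrite mulmxBr mul_mx_scalar mulmxDl mul1mx opprD addrA.
by rewrite -expand /Phat QE ZE.
Qed.

(** The factors cancelled are det (X + 1), a monic polynomial in u, and
    det M, a unit because q has an invertible constant coefficient. *)
Lemma Phat_transpose (r : A) : r * q`_0 = 1 ->
  Phat n q = \det (v *: X - (X + 1%:M) *m (K^cc)).
Proof.
move=> rq; rewrite PhatE.
have cbin : binom_mx^cc = binom_mx :> 'M[P]_n.
  by apply/matrixP => a b; rewrite !mxE rmorphMn rmorph_sign.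
have csh : shift_mx^cc = shift_mx :> 'M[P]_n.
  by apply/matrixP => a b; rewrite !mxE rmorph_nat.
have -> : K^cc = (hankel n q)^cc *m binom_mx^T.
  by rewrite map_mxM -map_trmx cbin.
have regH : GRing.lreg (\det ((X + 1%:M) *m (hankel n q)^cc)).
  rewrite det_mulmx; apply: lregM.
    rewrite (_ : X + 1%:M = (u + 1)%:M - shift_mx); last first.
      by rewrite raddfD /= addrAC.
    rewrite det_shift; apply: lregX; apply: lreg_lead.
    rewrite -polyCD lead_coefC; apply: monic_lreg.
    by rewrite -[1]opprK -[- 1]polyCN monicXsubC.
  rewrite det_map_mx; have [s ->] := det_hankel n q.
  apply: mulrI0_lreg => y; move/(congr1 ( *%R (cc (r ^+ n * (-1) ^+ s)))).
  rewrite mulr0 mulrA -rmorphM mulrA -[_ * _ * (-1) ^+ s]mulrA -expr2 sqrr_sign.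
  by rewrite mulr1 -exprMn rq expr1n rmorph1 mul1r.
apply: regH; rewrite [RHS]mulrC; apply: (@det_swap P n u v _ binom_mx shift_mx).
  by rewrite map_trmx hankel_tr.
by rewrite -csh -!map_mxM -hankel_shift map_mxM map_trmx.
Qed.

(** The rank one relation turns the determinant into that of (v - K) X - q e1;
    the generating function W of the recursion solves (v - K) W = - (v - 1)^n q,
    so that up to the factor (v - 1)^n this matrix is v - K times a companion
    matrix. *)
Theorem Phat_fusion (r : A) (T0 T : nat -> {poly A}) :
    r * q`_0 = 1 ->
    fusion_family n q (fun m => (m == 0%N)%:R) T0 -> T0 0%N = 'X^n ->
    (forall m, (T0 m.+1)`_n' = (-1) ^+ m *+ n) ->
    fusion_family n q (fun m => 'C(n, m)%:R) T -> T 0%N = 'X^n ->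
  Phat n q = \sum_(m < n.+1) ((-1) ^+ m * T m)%:P * 'X^(n - m).
Proof.
move=> rq famT0 T00 subT0 famT T00'; rewrite (Phat_transpose rq).
have charK : char_poly K = ('X - 1) ^+ n by apply: lax_mx_char_poly famT0 T00 subT0.
have CH : (1 - K) ^+ n = 0.
  have := Cayley_Hamilton K; rewrite charK rmorphXn rmorphB /= horner_mx_X rmorph1.
  by move=> K1; rewrite -opprB exprNn K1 mulr0.
have wT m : lower_coefs n (T m) = \sum_(l < m) 'C(n, l)%:R *: ((- K) ^+ (m.-1 - l) *m qcol n q).
  elim: m => [|m IHm]; first by rewrite T00' lower_coefsXn big_ord0.
  rewrite (fusion_rec _ famT) big_ord_recr /= subnn expr0 mul1mx; congr (_ + _).
  rewrite IHm mulmx_sumr -sumrN; apply: eq_bigr => l _.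
  rewrite -scalemxAr -scalerN -mulNmx [- K *m (_ *m _)]mulmxA; congr (_ *: (_ *m _)).
  rewrite [LHS](_ : _ = (- K) ^+ (m.-1 - l).+1); last by rewrite exprS.
  by congr (_ ^+ _); have := ltn_ord l; lia.
(* This is (1 - K)^n q; that it vanishes leaves no remainder when the generating
   function W is multiplied by v - K. *)
have wn1 : lower_coefs n (T n.+1) = 0.
  rewrite wT (_ : \sum_(l < n.+1) _ = (1 - K) ^+ n *m qcol n q); last first.
    rewrite addrC exprDn_comm; last exact: commr1.
    rewrite mulmx_suml; apply: eq_bigr => l _.
    by rewrite expr1n mulr1 -[X in _ = X *m _]scaler_nat -scalemxAl.
  by rewrite CH mul0mx.
pose chi : P := (v - 1) ^+ n.
pose vK : 'M[P]_n := v%:M - K^cc.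
have det_vK : \det vK = chi.
  have -> : vK = map_mx (map_poly polyC) (char_poly_mx K).
    by apply/matrixP => i j; rewrite !mxE rmorphB rmorphMn /= map_polyX map_polyC.
  by rewrite det_map_mx [\det _]charK rmorphXn rmorphB /= map_polyX rmorph1.
have chiE : \sum_(m < n.+1) ((-1) ^+ m * v ^+ (n - m)) * cc 'C(n, m)%:R = chi.
  rewrite /chi exprBn; apply: eq_bigr => m _.
  by rewrite expr1n mulr1 rmorph_nat mulr_natr.
pose W : 'cV[P]_n := \sum_(m < n.+1) ((-1) ^+ m * v ^+ (n - m)) *: (lower_coefs n (T m))^cc.
have vKW : vK *m W = - (chi *: (qcol n q)^cc).
  pose wc m := (lower_coefs n (T m))^cc.
  have Kwc m : K^cc *m wc m = cc 'C(n, m)%:R *: (qcol n q)^cc - wc m.+1.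
    rewrite /wc (fusion_rec _ famT) map_mxD map_mxN (map_mxM cc K) map_mxZ opprD opprK.
    by rewrite addrCA addrN addr0.
  rewrite mulmxBl mul_scalar_mx /W mulmx_sumr scaler_sumr.
  rewrite [X in _ - X](eq_bigr (fun m : 'I_n.+1 =>
    ((-1) ^+ m * v ^+ (n - m) * cc 'C(n, m)%:R) *: (qcol n q)^cc -
    ((-1) ^+ m * v ^+ (n - m)) *: wc m.+1)); last first.
    by move=> m _; rewrite -scalemxAr Kwc scalerBr scalerA.
  have -> : \sum_(m < n.+1) v *: (((-1) ^+ m * v ^+ (n - m)) *: wc m) =
      - \sum_(m < n) ((-1) ^+ m * v ^+ (n - m)) *: wc m.+1.
    rewrite big_ord_recl {1}/wc T00' lower_coefsXn map_mx0 !scaler0 add0r -sumrN.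
    apply: eq_bigr => m _; rewrite scalerA -scaleNr mulrCA -exprS /=.
    by rewrite [(-1) ^+ _]exprS mulN1r mulNr subnSK.
  have wcn1 : wc n.+1 = 0 by rewrite /wc wn1 map_mx0.
  rewrite sumrB -scaler_suml chiE [X in _ - (_ - X)]big_ord_recr /= wcn1 scaler0 addr0.
  by rewrite opprB addKr.
have detE : chi ^+ n * \det (v *: X - (X + 1%:M) *m (K^cc)) = chi * \det (chi *: X + W *m e1).
  rewrite -detZ -[X in _ = X * _]det_vK -det_mulmx; congr determinant.
  rewrite mulmxDr -scalemxAr mulmxA vKW mulNmx -scalemxAl -scalerBr; congr (_ *: _).
  have KE : K^cc = shift_mx *m K^cc - K^cc *m shift_mx + (qcol n q)^cc *m e1.
    have -> : e1 = e1^cc :> 'rV[P]_n by apply/rowP => b; rewrite !mxE rmorph_nat.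
    have -> : shift_mx = shift_mx^cc :> 'M[P]_n.
      by apply/matrixP => a b; rewrite !mxE rmorph_nat.
    by rewrite -!map_mxM -map_mxB -map_mxD -lax_mx_shift.
  exact: rank_one_shift.
have reg_chi : GRing.lreg chi.
  by apply/lregX/monic_lreg; rewrite -[1]/(1%:P) monicXsubC.
have reg_u : GRing.lreg u.
  by apply: lreg_lead; rewrite lead_coefC; apply/monic_lreg/monicX.
apply: (lregX reg_chi : GRing.lreg (chi ^+ n)); rewrite detE det_shift_e1 //.
congr (_ * _).
have TE m : (T m)%:P = cc 'C(n, m)%:R * u ^+ n +
    \sum_(a < n) cc (T m)`_(n.-1 - a) * u ^+ (n.-1 - a) :> P.
  have Tm : T m = \sum_(i < n.+1) ((T m)`_i)%:P * 'X^i.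
    rewrite -{1}(coefK (T m)) poly_def.
    rewrite (big_ord_widen _ (fun i => (T m)`_i *: 'X^i) (fusion_size famT m)).
    rewrite big_mkcond; apply: eq_bigr => i _; rewrite mul_polyC.
    by case: ifP => // /negbT; rewrite -leqNgt => le_i; rewrite nth_default ?scale0r.
  rewrite [in LHS]Tm rmorph_sum big_ord_recr /= addrC (fusion_top famT) rmorphM rmorphXn.
  congr (_ + _); rewrite (reindex_inj rev_ord_inj); apply: eq_bigr => a _.
  by rewrite rmorphM rmorphXn /= subSS.
rewrite -chiE mulr_suml.
under [X in _ + X = _]eq_bigr => a _ do rewrite summxE mulr_suml.
rewrite exchange_big -big_split; apply: eq_bigr => m _ /=.
have -> : ((-1) ^+ m * T m)%:P * 'X^(n - m) = (-1) ^+ m * v ^+ (n - m) * (T m)%:P.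
  by rewrite rmorphM rmorph_sign mulrAC.
rewrite TE mulrDr [in RHS]mulrA; congr (_ + _).
by rewrite mulr_sumr; apply: eq_bigr => a _; rewrite !mxE mulrA.
Qed.

End SpectralTheorem.

Corollary Phat_fusion_family (F : numFieldType) (A : comAlgType F) n
    (q : {poly A}) (r : A) (T0 T : nat -> {poly A}) :
    (0 < n)%N -> r * q`_0 = 1 ->
    fusion_family n q (fun m => (m == 0%N)%:R) T0 -> T0 0%N = 'X^n ->
    (forall m, (T0 m.+1)`_n.-1 = (-1) ^+ m *+ n) ->
    fusion_family n q (fun m => 'C(n, m)%:R) T -> T 0%N = 'X^n ->
  Phat n q = \sum_(m < n.+1) ((-1) ^+ m * T m)%:P * 'X^(n - m).
Proof. by case: n => // n' _; apply: Phat_fusion. Qed.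

(** * Deleting symbols from permutations *)

Section DeletingSymbols.
Local Open Scope group_scope.

(* Decides identities between nested conditionals on equality tests; the
   hypotheses of the form a = b -> c = d are instances of injectivity. *)
Local Ltac case_eqs :=
  repeat (case: eqP => ?);
  repeat match goal with H : context [@eq_op _ _ _] |- _ => revert H; case: eqP => ? ? end;
  try reflexivity; try congruence;
  try (match goal with inj : _ = _ -> _ = _ |- _ =>
         exfalso; (have ? := inj ltac:(congruence)); congruence end).

Section DeletePoint.
Variable T : finType.
Implicit Types (s t : {perm T}) (x y z : T) (xs : seq T).

(** Cuts x out of its cycle and leaves it as a fixed point. *)
Definition delp x s : {perm T} := s * tperm x (s x).

Lemma delpE x s y :
  delp x s y = if y == x then x else if s y == x then s x else s y.
Proof.
rewrite permM; case: eqP => [->|nyx]; first by rewrite tpermR.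
case: eqP => [->|nx]; first by rewrite tpermL.
by rewrite tpermD // eq_sym; apply/eqP => // /perm_inj.
Qed.

Lemma delp_id x s : delp x s x = x. Proof. by rewrite delpE eqxx. Qed.

Lemma delp_fix x s y : s y = y -> delp x s y = y.
Proof.
by move=> sy; rewrite delpE; case: eqP => // _; rewrite sy; case: eqP => // <-.
Qed.

Lemma delp_idl x s : s x = x -> delp x s = s.
Proof. by rewrite /delp => ->; rewrite tperm1 mulg1. Qed.

Lemma delpMl x s t : t x = x -> delp x (t * s) = t * delp x s.
Proof. by move=> tx; rewrite /delp permM tx mulgA. Qed.

Lemma delpMr x s t : t x = x -> delp x (s * t) = delp x s * t.
Proof.
move=> tx; rewrite /delp permM -{1}tx -tpermJ conjgE.
by rewrite !mulgA mulgK.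
Qed.

Lemma delpJ x s t : delp (t x) (s ^ t) = delp x s ^ t.
Proof. by rewrite /delp permJ -tpermJ -conjMg. Qed.

Lemma delpC x y s : delp x (delp y s) = delp y (delp x s).
Proof.
apply/permP => z; rewrite !delpE.
have ixy : s x = s y -> x = y by apply: perm_inj.
have ixz : s x = s z -> x = z by apply: perm_inj.
have iyz : s y = s z -> y = z by apply: perm_inj.
case_eqs.
Qed.

(** Either sum is the number of cycles of s contained in the set {x, y}, for x
    and y distinct. *)
Lemma delp_count x y s :
  ((s x == x) + (delp x s y == y) = (s y == y) + (delp y s x == x))%N.
Proof.
have ixy : s x = s y -> x = y by apply: perm_inj.
rewrite !delpE; case_eqs.
Qed.

(** Cutting out a point that is not fixed splits its orbit in two. *)
Lemma card_porbits_delp x s :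
  (#|porbits (delp x s)| = #|porbits s| + (s x != x))%N.
Proof.
have -> : delp x s = tperm (s^-1 x) x * s.
  by rewrite [RHS]conjgC tpermJ permKV.
have := porbits_mul_tperm s (s^-1 x) x.
have -> : s^-1 x \in porbit s x.
  by rewrite porbit_sym; apply/porbitP; exists 1%N; rewrite expg1 permKV.
by rewrite /= addn0 => ->; rewrite -(inj_eq (@perm_inj _ s)) permKV eq_sym.
Qed.

End DeletePoint.

Section ExtendPerm.
Variables (T T' : finType) (f : T -> T').
Hypothesis f_inj : injective f.
Implicit Types (s t : {perm T}).

Definition fext_fun s y := if [pick x | f x == y] is Some x then f (s x) else y.

Fact fext_fun_inj s : injective (fext_fun s).
Proof.
move=> y y'; rewrite /fext_fun.
case: pickP => [x /eqP<-|ny]; case: pickP => [x' /eqP<-|ny'] //.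
- by move/f_inj/perm_inj->.
- by move=> e; have := ny' (s x); rewrite e eqxx.
- by move=> e; have := ny (s x'); rewrite -e eqxx.
Qed.

(** The permutation of T' that is s on the image of f and the identity
    elsewhere. *)
Definition fext s : {perm T'} := perm (@fext_fun_inj s).

Lemma fextE s x : fext s (f x) = f (s x).
Proof.
rewrite permE /fext_fun; case: pickP => [x' /eqP/f_inj->//|/(_ x)].
by rewrite eqxx.
Qed.

Lemma fext_out s y : y \notin codom f -> fext s y = y.
Proof.
rewrite permE /fext_fun; case: pickP => // x /eqP<-.
by rewrite codom_f.
Qed.

Lemma fext_eq s (r : {perm T'}) : (forall x, r (f x) = f (s x)) ->
  (forall y, y \notin codom f -> r y = y) -> r = fext s.
Proof.
move=> rf rout; apply/permP => y; have [/codomP[x ->]|ny] := boolP (y \in codom f).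
  by rewrite rf fextE.
by rewrite rout ?fext_out.
Qed.

Lemma fext1 : fext 1 = 1.
Proof. by symmetry; apply: fext_eq => *; rewrite !perm1. Qed.

Lemma fextM s t : fext (s * t) = fext s * fext t.
Proof.
symmetry; apply: fext_eq => [x|y ny]; first by rewrite permM !fextE permM.
by rewrite permM !fext_out.
Qed.

Lemma fext_inj : injective fext.
Proof.
by move=> s t e; apply/permP => x; apply: f_inj; rewrite -!fextE e.
Qed.

Lemma fext_tperm x y : fext (tperm x y) = tperm (f x) (f y).
Proof.
symmetry; apply: fext_eq => [z|z nz]; first by rewrite -inj_tperm.
by rewrite tpermD //; apply: contraNneq nz => <-; apply: codom_f.
Qed.

Lemma fext_delp x s : fext (delp x s) = delp (f x) (fext s).
Proof. by rewrite /delp fextM fext_tperm fextE. Qed.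

Lemma fextX s i : fext (s ^+ i) = fext s ^+ i.
Proof. by elim: i => [|i IHi]; rewrite ?fext1 // !expgS fextM IHi. Qed.

(** The orbits are the images of those of s and the singletons outside the
    image of f. *)
Lemma card_porbits_fext s : (#|porbits (fext s)| = #|porbits s| + (#|T'| - #|T|))%N.
Proof.
have orbf x : porbit (fext s) (f x) = [set f z | z in porbit s x].
  apply/setP => y; apply/porbitP/imsetP => [[i ->]|[z /porbitP[i ->] ->]].
    by exists ((s ^+ i) x); rewrite ?mem_porbit // -fextX fextE.
  by exists i; rewrite -fextX fextE.
have orbo y : y \notin codom f -> porbit (fext s) y = [set y].
  move=> ny; apply/setP => z; rewrite inE; apply/porbitP/eqP => [[i ->]|->].
    by rewrite -fextX fext_out.
  by exists 0%N; rewrite perm1.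
have -> : porbits (fext s) =
    [set [set f z | z in O : {set T}] | O in porbits s] :|: [set [set y] | y in [predC codom f]].
  apply/setP => O; rewrite inE; apply/imsetP/orP => [[y _ ->]|].
    have [/codomP[x ->]|ny] := boolP (y \in codom f).
      by left; rewrite orbf imset_f // imset_f.
    by right; rewrite orbo // imset_f.
  case=> /imsetP[].
    by move=> _ /imsetP[x _ ->] ->; exists (f x); rewrite // orbf.
  by move=> y ny ->; exists y; rewrite // orbo.
rewrite cardsU card_imset; last by apply: imset_inj.
rewrite (card_imset _ (@set1_inj T')).

have -> : #|[predC codom f]| = (#|T'| - #|T|)%N.
  by have := cardC (mem (codom f)); rewrite card_codom // => <-; rewrite addKn.
rewrite (_ : _ :&: _ = set0) ?cards0 ?subn0 //.
apply/setP => O; rewrite !inE; apply/negP => /andP[/imsetP[_ /imsetP[x _ ->] ->]].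
case/imsetP=> y ny /setP/(_ (f x)); rewrite imset_f ?porbit_id // inE.
by move/esym/eqP => e; move: ny; rewrite inE -e codom_f.
Qed.

End ExtendPerm.

Section FirstReturn.
Variables (T : finType) (D : pred T).
Implicit Types (s : {perm T}) (x y z : T) (xs : seq T).

(** The orbit of x under s is first outside D after k + 1 steps, at y. *)
Fixpoint first_return s k x y :=
  if k is k'.+1 then D (s x) && first_return s k' (s x) y
  else (s x == y) && ~~ D y.

(** Cutting out a point of D only shortens the excursion; induction on its
    length. *)
Lemma first_return_delp s k x y z : D z -> x != z -> first_return s k x y ->
  exists k', first_return (delp z s) k' x y.
Proof.
have [m] := ubnP k; elim: m k x => // m IHm [|k] x /= lt_km Dz nxz.
  case/andP=> /eqP sxy nDy; exists 0%N; rewrite /= nDy andbT delpE (negPf nxz) sxy.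
  by rewrite ifN ?eqxx //; apply: contraNneq nDy => ->.
case/andP=> Dsx; have [sxz|nsxz] := eqVneq (s x) z; last first.
  case/(IHm _ _ _ Dz nsxz) => // k' fr; exists k'.+1.
  by rewrite /= delpE (negPf nxz) (negPf nsxz) Dsx.
have delx : delp z s x = s z by rewrite delpE (negPf nxz) sxz eqxx.
rewrite sxz; case: k lt_km => [|k] lt_km /=; case/andP.
  by move=> /eqP <- nD; exists 0%N; rewrite /= delx eqxx.
move=> Dsz fr; have nszz : s z != z by rewrite -{2}sxz (inj_eq perm_inj) eq_sym.
have [|k' fr'] := IHm k (s z) _ Dz nszz fr; first by rewrite ltnW.
by exists k'.+1; rewrite /= delx Dsz.
Qed.

Definition delall xs s := foldr (@delp T) s xs.

Lemma first_return_delall s k x y xs : all D xs -> ~~ D x -> first_return s k x y ->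
  exists k', first_return (delall xs s) k' x y.
Proof.
move=> Dxs nDx; elim: xs Dxs s k => [|z xs IHxs] /=; first by move=> _ s k; exists k.
case/andP=> Dz /IHxs{}IHxs s k /IHxs[k' fr]; apply: first_return_delp fr => //.
by apply: contraNneq nDx => ->.
Qed.

Lemma delall_fix s xs x : x \in xs -> delall xs s x = x.
Proof.
elim: xs => //= y xs IHxs; rewrite inE => /orP[/eqP<-|/IHxs]; first exact: delp_id.
exact: delp_fix.
Qed.

(** Once every point of D is fixed, an excursion through D is impossible, so
    the first return is the image itself. *)
Lemma delall_first_return s k x y xs : D =i xs -> ~~ D x -> first_return s k x y ->
  delall xs s x = y.
Proof.
move=> Dxs nDx; have Dall : all D xs by apply/allP => z; rewrite -Dxs.
case/(first_return_delall Dall nDx) => -[|k'] /=; first by case/andP=> /eqP.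
case/andP=> Dr _; have := Dr; rewrite -[D _]/(_ \in D) Dxs => /(delall_fix s).
by move/perm_inj=> rx; rewrite rx (negPf nDx) in Dr.
Qed.

End FirstReturn.
(** The symbols n + 1, ..., n + m. *)
Definition aux n m : seq 'I_(n + m) := [seq rshift n i | i <- enum 'I_m].

Section DelPerm.
Variables (n m : nat).
Implicit Types s : 'S_(n + m).

Let D : pred 'I_(n + m) := mem (aux n m).

Lemma aux_rshift i : rshift n i \in aux n m.
Proof. by rewrite map_f // mem_enum. Qed.

Lemma aux_lshift j : lshift m j \notin aux n m.
Proof. by apply/mapP => -[i _] /eqP; rewrite eq_lrshift. Qed.

Lemma rshift_inv i : lshift_inv (rshift n i : 'I_(n + m)) = None.
Proof.
rewrite /lshift_inv; case: (split_ordP (rshift n i)) => j // /eqP.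
by rewrite eq_rlshift.
Qed.

Lemma del_fun_head s j k w :
    iter k s (s w) = lshift m j ->
  exists k', first_return D s k' w
    (lshift m (head j (pmap (@lshift_inv n m) (traject s (s w) k)))).
Proof.
elim: k w => [|k IHk] w.
  by move=> /= sw; exists 0%N; rewrite /= sw eqxx; apply: aux_lshift.
rewrite iterSr trajectS /= => /IHk[k' fr].
case: (split_ordP (s w)) fr => i swE fr.
  by exists 0%N; rewrite /= swE lshiftK /= eqxx; apply: aux_lshift.
have -> : lshift_inv (s w) = None by rewrite swE rshift_inv.
by exists k'.+1; rewrite /= fr andbT swE; apply: aux_rshift.
Qed.

(** Reading a cycle without the deleted symbols is taking first returns. *)
Lemma fext_del_perm s : fext (@lshift_inj n m) (del_perm s) = delall (aux n m) s.
Proof.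
symmetry; apply: fext_eq => [j|y]; last first.
  case: (split_ordP y) => i ->; first by rewrite codom_f.
  by rewrite delall_fix ?aux_rshift.
rewrite permE /del_fun /del_cycle /fingraph.orbit.
have [k ordE] : exists k, fingraph.order s (lshift m j) = k.+1.
  by exists (fingraph.order s (lshift m j)).-1; rewrite orderSpred.
rewrite ordE trajectS /= lshiftK /=.
have [|k' fr] := @del_fun_head s j k (lshift m j).
  by rewrite -iterSr -ordE iter_order //; apply: perm_inj.
have -> := @delall_first_return _ D s k' (lshift m j) _ (aux n m) _ _ fr => //.
  by congr lshift; case: (pmap _ _) => //= *; rewrite eqxx.
exact: aux_lshift.
Qed.

End DelPerm.

End DeletingSymbols.

(** * Conditional expectations of the group algebra *)

Section LinearExtension.
Variables (F : fieldType) (N : nat) (V : lmodType F) (f : 'S_N -> V).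
Implicit Types (y z : symalg F N).

Definition lin_ext y : V := \sum_s (y s : F) *: f s.

Fact lin_ext_linear : linear lin_ext.
Proof.
move=> a y z; rewrite /lin_ext scaler_sumr -big_split; apply: eq_bigr => s _ /=.
by rewrite !ffunE scalerDl scalerA.
Qed.
HB.instance Definition _ :=
  GRing.isLinear.Build F (symalg F N) V *:%R lin_ext lin_ext_linear.

Lemma lin_ext_gen s : lin_ext (sgen F s) = f s.
Proof.
rewrite /lin_ext (bigD1 s) //= ffunE eqxx scale1r big1 ?addr0 // => t /negPf nts.
by rewrite ffunE nts scale0r.
Qed.

End LinearExtension.

Section Generators.
Variables (F : fieldType) (N : nat).
Implicit Types (y z : symalg F N) (s t : 'S_N) (x : 'I_N).

Lemma sgen_sum y : y = \sum_s (y s : F) *: sgen F s.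
Proof.
apply/ffunP => s; rewrite sum_ffunE (bigD1 s) //= big1 => [|t /negPf nt].
  by rewrite !ffunE eqxx addr0; symmetry; apply: mulr1.
by rewrite !ffunE eq_sym nt; apply: mulr0.
Qed.

Lemma symalg_ind (P : symalg F N -> Prop) :
  P 0 -> (forall a s y, P y -> P (a *: sgen F s + y)) -> forall y, P y.
Proof.
move=> P0 PD y; rewrite (sgen_sum y); elim/big_rec: _ => // s z _.
exact: PD.
Qed.

Lemma linear_eq (V : lmodType F) (f g : {linear symalg F N -> V}) :
  (forall s, f (sgen F s) = g (sgen F s)) -> f =1 g.
Proof.
move=> fg y; rewrite (sgen_sum y) !linear_sum; apply: eq_bigr => s _.
by rewrite !linearZ fg.
Qed.

Lemma sgen1 : sgen F 1%g = 1 :> symalg F N. Proof. by []. Qed.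

Lemma sgenVK s : sgen F s * sgen F s^-1%g = 1.
Proof. by rewrite sgenM mulVg. Qed.

Lemma sgenKV s : sgen F s^-1%g * sgen F s = 1.
Proof. by rewrite sgenM mulgV. Qed.

(** All permutations in the support of y fix x. *)
Definition fixes x y := forall s, y s != 0 -> s x = x.

Lemma fixes_sgen x s : s x = x -> fixes x (sgen F s).
Proof. by move=> sx t; rewrite ffunE; have [->//|_] := eqVneq t s; rewrite eqxx. Qed.

Lemma fixes0 x : fixes x 0. Proof. by move=> s; rewrite ffunE eqxx. Qed.

Lemma fixesD x y z : fixes x y -> fixes x z -> fixes x (y + z).
Proof.
move=> fy fz s; rewrite ffunE; have [/eqP y0|/fy//] := boolP (y s == 0).
by rewrite y0 add0r => /fz.
Qed.

Lemma fixesZ x a y : fixes x y -> fixes x (a *: y).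
Proof.
move=> fy s; rewrite ffunE; have [/eqP ->|/fy//] := boolP (y s == 0).
by rewrite scaler0 eqxx.
Qed.

Lemma fixes_lin_ext x M (g : 'S_M -> symalg F N) (w : symalg F M) :
  (forall s : 'S_M, w s != 0 -> fixes x (g s)) -> fixes x (lin_ext g w).
Proof.
move=> fg; rewrite /lin_ext; elim/big_rec: _ => [|s z _]; first exact: fixes0.
apply: fixesD; have [/eqP ->|/fg] := boolP (w s == 0); last exact: fixesZ.
by rewrite scale0r; apply: fixes0.
Qed.

Lemma fixesM_ind x y (P : symalg F N -> Prop) : fixes x y ->
    P 0 -> (forall a s z, s x = x -> P z -> P (a *: sgen F s + z)) -> P y.
Proof.
move=> fy P0 PD; rewrite (sgen_sum y); elim/big_rec: _ => // s z _ Pz.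
have [/eqP ->|/fy sx] := boolP (y s == 0); last exact: PD.
by rewrite scale0r add0r.
Qed.

End Generators.

Section Expectation.
Variables (F : fieldType) (p : F) (N : nat).
Implicit Types (y z w : symalg F N) (s t : 'S_N) (x : 'I_N) (xs : seq 'I_N).

(** The one-symbol trace, with values in the same group algebra: x becomes a
    fixed point, and a factor p is recorded if it was a cycle by itself. *)
Definition expect x : symalg F N -> symalg F N :=
  lin_ext (fun s => p ^+ (s x == x) *: sgen F (delp x s)).
HB.instance Definition _ x := GRing.Linear.on (expect x).

Lemma expectZ x a y : expect x (a *: y) = a *: expect x y.
Proof. exact: linearZ. Qed.

Lemma expect_gen x s : expect x (sgen F s) = p ^+ (s x == x) *: sgen F (delp x s).
Proof. exact: lin_ext_gen. Qed.

Lemma expect_fixes x y : fixes x (expect x y).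
Proof. by apply: fixes_lin_ext => s _; apply/fixesZ/fixes_sgen/delp_id. Qed.

Lemma expect_fixes_out x x' y : fixes x y -> fixes x (expect x' y).
Proof.
move=> fy; apply: fixes_lin_ext => s /fy sx.
by apply/fixesZ/fixes_sgen/delp_fix.
Qed.

(** With [expectMr], linearity over the permutations that fix x. *)
Lemma expectMl x z y : fixes x z -> expect x (z * y) = z * expect x y.
Proof.
move=> fz; pose P z := expect x (z * y) = z * expect x y.
apply: (fixesM_ind (P := P) fz) => [|a s {fz}z sx]; rewrite /P {P}.
  by rewrite !mul0r linear0.
move=> IHz; rewrite !mulrDl linearD /= IHz -!scalerAl linearZ /=; congr (_ *: _ + _).
elim/symalg_ind: y {IHz} => [|b t y IHy]; first by rewrite !(mulr0, linear0).
rewrite linearD linearZ /= !mulrDr linearD /= IHy -!scalerAr linearZ /=.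
congr (_ *: _ + _); rewrite sgenM !expect_gen delpMr // -scalerAr sgenM permM.
by rewrite -{2}sx (inj_eq perm_inj).
Qed.

Lemma expectMr x z y : fixes x z -> expect x (y * z) = expect x y * z.
Proof.
move=> fz; pose P z := expect x (y * z) = expect x y * z.
apply: (fixesM_ind (P := P) fz) => [|a s {fz}z sx]; rewrite /P {P}.
  by rewrite !mulr0 linear0.
move=> IHz; rewrite !mulrDr linearD /= IHz -!scalerAr linearZ /=; congr (_ *: _ + _).
elim/symalg_ind: y {IHz} => [|b t y IHy]; first by rewrite !(mul0r, linear0).
rewrite linearD linearZ /= !mulrDl linearD /= IHy -!scalerAl linearZ /=.
congr (_ *: _ + _); rewrite sgenM !expect_gen delpMl // -scalerAl sgenM permM.
by rewrite sx.
Qed.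

Lemma expectC x x' y : expect x (expect x' y) = expect x' (expect x y).
Proof.
apply: (linear_eq (f := expect x \o expect x') (g := expect x' \o expect x)) => s /=.
rewrite !expect_gen !expectZ !expect_gen !scalerA delpC -!exprD.
by rewrite delp_count.
Qed.

Lemma expectJ x t y :
  expect (t x) (sgen F t * y * sgen F t^-1%g) = sgen F t * expect x y * sgen F t^-1%g.
Proof.
elim/symalg_ind: y => [|a s y IHy]; first by rewrite !(linear0, mulr0, mul0r).
rewrite linearD linearZ /= !(mulrDr, mulrDl) linearD /= {}IHy; congr (_ + _).
rewrite -!(scalerAr, scalerAl) linearZ /= !expect_gen -!(scalerAr, scalerAl).
rewrite !sgenM -!mulgA -!conjgE expect_gen delpJ permJ (inj_eq perm_inj).
by rewrite /delp conjgE !mulgA.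
Qed.

Definition expects xs y := foldr expect y xs.

Fact expects_linear xs : linear (expects xs).
Proof.
by elim: xs => [|x xs IHxs] a y z //=; rewrite IHxs linearP.
Qed.
HB.instance Definition _ xs :=
  GRing.isLinear.Build F (symalg F N) (symalg F N) *:%R (expects xs) (expects_linear xs).

Lemma expects_cat xs ys y : expects (xs ++ ys) y = expects xs (expects ys y).
Proof. exact: foldr_cat. Qed.

Lemma expects_rem x xs y : x \in xs -> expects xs y = expect x (expects (rem x xs) y).
Proof.
elim: xs => //= x' xs IHxs; rewrite inE eq_sym; have [->//|_ /=] := eqVneq.
by move/IHxs => ->; rewrite expectC.
Qed.

Lemma expects_perm xs ys y : perm_eq xs ys -> expects xs y = expects ys y.
Proof.
elim: xs ys => [|x xs IHxs] ys; first by move/perm_size/esym/size0nil->.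
move=> eq_xs; have xys : x \in ys by rewrite -(perm_mem eq_xs) mem_head.
rewrite (expects_rem _ xys) /= (IHxs (rem x ys)) //.
by rewrite -(perm_cons x) (perm_trans eq_xs) // perm_to_rem.
Qed.

Lemma expectsMl xs z y : {in xs, forall x, fixes x z} ->
  expects xs (z * y) = z * expects xs y.
Proof.
elim: xs => //= x xs IHxs fz; rewrite IHxs => [|x' x'xs]; last first.
  by apply: fz; rewrite inE x'xs orbT.
by rewrite expectMl //; apply: fz; apply: mem_head.
Qed.

Lemma expectsMr xs z y : {in xs, forall x, fixes x z} ->
  expects xs (y * z) = expects xs y * z.
Proof.
elim: xs => //= x xs IHxs fz; rewrite IHxs => [|x' x'xs]; last first.
  by apply: fz; rewrite inE x'xs orbT.
by rewrite expectMr //; apply: fz; apply: mem_head.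
Qed.

Lemma expects_fixes x xs y : x \in xs -> fixes x (expects xs y).
Proof.
elim: xs => //= x' xs IHxs; rewrite inE => /predU1P[<-|/IHxs]; first exact: expect_fixes.
exact: expect_fixes_out.
Qed.

Lemma expectsJ xs t y :
  expects (map t xs) (sgen F t * y * sgen F t^-1%g) =
  sgen F t * expects xs y * sgen F t^-1%g.
Proof. by elim: xs => //= x xs ->; rewrite expectJ. Qed.

(** Cyclicity: conjugation by t permutes the deleted symbols, and t commutes
    with the permutations that fix all of them. *)
Lemma expects_cyc xs t y : perm_eq (map t xs) xs ->
    (forall x, x \notin xs -> t x = x) ->
  expects xs (y * sgen F t) = expects xs (sgen F t * y).
Proof.
move=> txs tout; set w := y * sgen F t.
have -> : sgen F t * y = sgen F t * w * sgen F t^-1%g.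
  by rewrite /w -!mulrA sgenVK mulr1.
rewrite -[RHS](expects_perm _ txs) expectsJ.
suff comm z : {in xs, forall x, fixes x z} -> sgen F t * z = z * sgen F t.
  rewrite comm; last by move=> x xxs; apply: expects_fixes.
  by rewrite -mulrA sgenVK mulr1.
move=> fz; rewrite (sgen_sum z) mulr_sumr mulr_suml; apply: eq_bigr => s _.
rewrite -scalerAr -scalerAl; have [/eqP ->|zs] := boolP (z s == 0).
  by rewrite !scale0r.
have sfix x : x \in xs -> s x = x by move=> /fz/(_ s zs).
congr (_ *: _); rewrite !sgenM; congr sgen; apply/permP => x; rewrite !permM.
have [xxs|xxs] := boolP (x \in xs).
  by rewrite [s x]sfix // sfix // -(perm_mem txs) map_f.
rewrite (tout x) // tout //; apply: contra xxs => sxs.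
by rewrite -(perm_inj (sfix _ sxs)).
Qed.

(** The exponent is found by counting orbits: a deletion adds an orbit exactly
    when it does not contribute a factor p. *)
Lemma expects_gen xs s : exists2 e,
  expects xs (sgen F s) = p ^+ e *: sgen F (delall xs s) &
  (#|porbits (delall xs s)| + e = #|porbits s| + size xs)%N.
Proof.
elim: xs => [|x xs [e expE cardE]] /=; first by exists 0%N; rewrite ?expr0 ?scale1r.
exists (e + (delall xs s x == x))%N.
  by rewrite expE linearZ /= expect_gen scalerA exprD.
rewrite card_porbits_delp addnS -cardE -/(delall xs s).
by case: eqP => _ /=; lia.
Qed.

End Expectation.

Section Push.
Variables (F : fieldType) (N M : nat) (f : 'I_N -> 'I_M).
Hypothesis f_inj : injective f.
Implicit Types (y z : symalg F N).

Definition push : symalg F N -> symalg F M := lin_ext (fun s => sgen F (fext f_inj s)).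
HB.instance Definition _ := GRing.Linear.on push.

Lemma push_gen s : push (sgen F s) = sgen F (fext f_inj s).
Proof. exact: lin_ext_gen. Qed.

Fact push_monoid : monoid_morphism push.
Proof.
split; first by rewrite -!sgen1 push_gen fext1.
move=> y z; elim/symalg_ind: y => [|a s y IHy]; first by rewrite !(mul0r, linear0).
rewrite mulrDl !linearD /= mulrDl {}IHy; congr (_ + _).
rewrite -scalerAl !linearZ /= -scalerAl; congr (_ *: _).
elim/symalg_ind: z => [|b t z IHz]; first by rewrite !(mulr0, linear0).
rewrite mulrDr !linearD /= mulrDr {}IHz; congr (_ + _).
rewrite -scalerAr !linearZ /= -scalerAr; congr (_ *: _).
by rewrite sgenM !push_gen sgenM fextM.
Qed.
HB.instance Definition _ :=
  GRing.isMonoidMorphism.Build (symalg F N) (symalg F M) push push_monoid.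

Lemma push_inj : injective push.
Proof.
move=> y z /ffunP yz; apply/ffunP => s; have := yz (fext f_inj s).
have pE w : push w (fext f_inj s) = w s.
  rewrite /push /lin_ext sum_ffunE (bigD1 s) //= big1 => [|t /negPf nt].
    by rewrite !ffunE eqxx addr0; apply: mulr1.
  rewrite !ffunE (inj_eq (@fext_inj _ _ _ f_inj)) eq_sym nt.
  exact: mulr0.
by rewrite !pE.
Qed.

Lemma push_fixes x y : x \notin codom f -> fixes x (push y).
Proof. by move=> nx; apply: fixes_lin_ext => s _; apply/fixes_sgen/fext_out. Qed.

Lemma expect_push p x y : expect p (f x) (push y) = push (expect p x y).
Proof.
elim/symalg_ind: y => [|a s y IHy]; first by rewrite !linear0.
rewrite !linearD !linearZ /= {}IHy; congr (_ *: _ + _).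
by rewrite push_gen !expect_gen linearZ /= push_gen fext_delp fextE (inj_eq f_inj).
Qed.

Lemma expects_push p xs y : expects p (map f xs) (push y) = push (expects p xs y).
Proof. by elim: xs => //= x xs ->; rewrite expect_push. Qed.

End Push.

Lemma push_comp (F : fieldType) N M L (f : 'I_N -> 'I_M) (g : 'I_M -> 'I_L)
    (h : 'I_N -> 'I_L) (f_inj : injective f) (g_inj : injective g)
    (h_inj : injective h) (y : symalg F N) : h =1 g \o f ->
  push g_inj (push f_inj y) = push h_inj y.
Proof.
move=> hE; elim/symalg_ind: y => [|a s y IHy]; first by rewrite !linear0.
rewrite !linearD !linearZ /= {}IHy; congr (_ *: _ + _).
rewrite !push_gen; congr sgen; apply: fext_eq => [x|z nz].
  by rewrite !hE /= !fextE.
have [/codomP[z' zE]|] := boolP (z \in codom g); last exact: fext_out.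
rewrite zE fextE fext_out //; apply: contra nz => /codomP[x z'E].
by rewrite zE z'E -[g _]/((g \o f) x) -hE codom_f.
Qed.

Section TraceExpectation.
Variables (F : fieldType) (n m : nat) (p : F).

Lemma Tr_lin_ext : @Tr F n m p =1 lin_ext (fun s =>
  p ^+ (#|porbits s| - #|porbits (del_perm s)|) *: sgen F (del_perm s)).
Proof. by move=> y; apply: eq_bigr => s _; rewrite scalerA. Qed.

Fact Tr_linear : linear (@Tr F n m p).
Proof. by move=> a y z; rewrite !Tr_lin_ext linearP. Qed.
HB.instance Definition _ :=
  GRing.isLinear.Build F (symalg F (n + m)) (symalg F n) *:%R (@Tr F n m p) Tr_linear.

(** The trace is the iterated one-symbol trace, up to the embedding of S_n. *)
Lemma push_Tr y :
  push (@lshift_inj n m) (Tr p y) = expects p (aux n m) y.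
Proof.
elim/symalg_ind: y => [|a s y IHy]; first by rewrite !linear0.
rewrite !linearD !linearZ /= {}IHy; congr (_ *: _ + _).
rewrite Tr_lin_ext lin_ext_gen linearZ /= push_gen fext_del_perm.
have [e -> cardE] := expects_gen p (aux n m) s; congr (_ ^+ _ *: _).
move: cardE; rewrite -fext_del_perm card_porbits_fext !card_ord size_map size_enum_ord.
by rewrite addKn addnAC => /addIn <-; rewrite addKn.
Qed.

End TraceExpectation.

(** * Identities behind fusion and the Yang-Baxter equation *)

Section AlgebraIdentities.
Variables (F : fieldType) (R : algType F).
Implicit Types (a b : F) (s x y : R).

Lemma mul_affine b y a x :
  (b%:A + y) * (a%:A + x) = (b * a)%:A + b *: x + a *: y + y * x.
Proof.
rewrite mulrDl -scalerAl mul1r mulrDr -scalerAr mulr1 scalerDr scalerA.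
by rewrite !addrA.
Qed.

(** The case of interest is e antisymmetric in all auxiliary symbols, with
    x = s_(j,0) and y = s_(j,1) + ... + s_(j,m). *)
Lemma fusion_left a x y e : e * (y * x) = - (e * y) ->
  e * (((a - 1)%:A + y) * (a%:A + x)) = (a - 1) *: (e * (a%:A + (x + y))).
Proof.
move=> eyx; rewrite mul_affine 3!mulrDr eyx -!scalerAr mulr1.
rewrite !mulrDr -scalerAr mulr1 !scalerDr scalerA -!addrA; congr (_ + (_ + _)).
by rewrite scalerBl scale1r.
Qed.

(** The case of interest is d = A - A'. *)
Lemma fusion_right a x y d : y * (x * d) = x * d ->
  ((a - 1)%:A + y) * (a%:A + x) * d = a *: (((a - 1)%:A + (x + y)) * d).
Proof.
move=> yxd; rewrite mul_affine 3!mulrDl -[y * x * d]mulrA yxd -!scalerAl mul1r.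
rewrite [(_%:A + _) * d]mulrDl [(x + y) * d]mulrDl -scalerAl mul1r !scalerDr scalerA [a * _]mulrC -!addrA; congr (_ + _).
by rewrite addrCA addrC; congr (_ + _); rewrite scalerBl scale1r subrK.
Qed.

(** The hypotheses hold for the three transpositions of three symbols. *)
Lemma yang_baxter a b s x y : s * s = 1 ->
    x * y = s * x -> x * y = y * s -> y * x = s * y -> y * x = x * s ->
  ((a - b)%:A + s) * ((a%:A + x) * (b%:A + y)) =
  ((b%:A + y) * (a%:A + x)) * ((a - b)%:A + s).
Proof.
move=> ss xy1 xy2 yx1 yx2.
have sxy : s * (x * y) = x by rewrite xy1 mulrA ss mul1r.
have yxs : y * x * s = x by rewrite yx2 -mulrA ss mulr1.
(* In terms of a - b and b the identity is linear after expansion. *)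
have -> : a = (a - b) + b by rewrite subrK.
move: (a - b) => {}a; rewrite addrK.
rewrite !mul_affine [b * _]mulrC; move: ((a + b) * b) => c.
rewrite mulrDl [RHS]mulrDr -!scalerAl -!scalerAr mul1r mulr1.
rewrite 3!mulrDr 3!mulrDl sxy yxs -!scalerAl -!scalerAr mulr1 mul1r.
rewrite -xy1 -yx1 -yx2 -xy2 6!scalerDr [_ *: (y * x)]scalerDl.
rewrite [(a + b) *: (x * y)]scalerDl.
by rewrite [LHS](AC (4*(1*2*1*1)) ((1*3*2*6)*(5*7*(4*8)*9))).
Qed.
End AlgebraIdentities.

Section Transpositions.
Variables (F : fieldType) (N : nat).
Implicit Types (x y z : 'I_N).

Lemma sgen_tperm2 x y : sgen F (tperm x y) * sgen F (tperm x y) = 1.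
Proof. by rewrite sgenM tperm2. Qed.

Lemma sgen_tperm_mull x y z : x != y -> x != z -> y != z ->
  sgen F (tperm x y) * sgen F (tperm x z) = sgen F (tperm y z) * sgen F (tperm x y).
Proof.
move=> xy xz yz; rewrite !sgenM; congr sgen.
by rewrite [LHS]conjgC tpermJ tpermL tpermD.
Qed.

Lemma sgen_tperm_mulr x y z : x != y -> x != z -> y != z ->
  sgen F (tperm x y) * sgen F (tperm x z) = sgen F (tperm x z) * sgen F (tperm y z).
Proof.
move=> xy xz yz; rewrite !sgenM; congr sgen.
have zy : z != y by rewrite eq_sym.
by rewrite [RHS]conjgC tpermJ tpermR (tpermD xy zy) [tperm y x]tpermC.
Qed.

Lemma fixes_comm_tperm x y (z : symalg F N) : fixes x z -> fixes y z ->
  GRing.comm z (sgen F (tperm x y)).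
Proof.
move=> fx fy; rewrite /GRing.comm {1 2}(sgen_sum z) mulr_suml mulr_sumr.
apply: eq_bigr => s _; rewrite -scalerAl -scalerAr.
have [/eqP ->|zs] := boolP (z s == 0); first by rewrite !scale0r.
congr (_ *: _); rewrite !sgenM; congr sgen.
by rewrite [LHS]conjgC tpermJ (fx s) // (fy s).
Qed.

End Transpositions.

(** * The antisymmetrizer *)

Section Antisymmetrizer.
Variables (F : numFieldType).

Lemma antisymMr m (t : 'S_m) : antisym F m * sgen F t = (-1) ^+ t *: antisym F m.
Proof.
rewrite /antisym -scalerAl mulr_suml [RHS]scalerA mulrC -scalerA; congr (_ *: _).
rewrite scaler_sumr [RHS](reindex_inj (mulgI t)); apply: eq_bigr => s _ /=.
by rewrite -scalerAl sgenM scalerA odd_permM signr_addb mulrA -signr_addb addbb mul1r.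
Qed.

Lemma antisymMl m (t : 'S_m) : sgen F t * antisym F m = (-1) ^+ t *: antisym F m.
Proof.
rewrite /antisym -scalerAr mulr_sumr [RHS]scalerA mulrC -scalerA; congr (_ *: _).
rewrite scaler_sumr [RHS](reindex_inj (mulIg t)); apply: eq_bigr => s _ /=.
by rewrite -scalerAr sgenM scalerA odd_permM signr_addb mulrCA -signr_addb addbb mulr1.
Qed.

Lemma antisym1 : antisym F 1 = 1.
Proof.
rewrite /antisym invr1 scale1r (eq_bigr (fun=> 1)).
  by rewrite sumr_const card_Sn.
move=> s _; have -> : s = 1%g by apply/permP => x; rewrite !ord1.
by rewrite odd_perm1 scale1r sgen1.
Qed.

Let lift_perm0 m := fext (@lift_inj m.+1 ord0).

(** Every permutation of 0, ..., m is uniquely t followed by the exchange of 0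
    with some k, where t fixes 0; it has the sign of t if k = 0 and the opposite
    sign otherwise. *)
Lemma antisym_rec m :
  (1 - \sum_(i < m) sgen F (tperm ord0 (lift ord0 i))) * push (@lift_inj m.+1 ord0) (antisym F m) =
  m.+1%:R *: antisym F m.+1.
Proof.
pose phi (kt : 'I_m.+1 * 'S_m) : 'S_m.+1 := (lift_perm0 kt.2 * tperm ord0 kt.1)%g.
have lift0 (t : 'S_m) : lift_perm0 t ord0 = ord0.
  by rewrite /lift_perm0 fext_out //; apply/codomP => -[x /eqP]; rewrite (negPf (neq_lift _ _)).
have odd_fext_lift (t : 'S_m) : odd_perm (lift_perm0 t) = odd_perm t.
  have <- : lift_perm ord0 ord0 t = lift_perm0 t; last by rewrite odd_lift_perm.
  apply: fext_eq => [x|y]; first by rewrite lift_perm_lift.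
  case: (unliftP ord0 y) => [x ->|->]; first by rewrite codom_f.
  by rewrite lift_perm_id.
have phi_inj : injective phi.
  move=> [k t] [k' t'] /= e.
  have ek : k = k'.
    by have := congr1 (fun s : 'S_m.+1 => s ord0) e; rewrite /phi !permM !lift0 !tpermL.
  congr (_, _) => //; move: e; rewrite /phi ek => /mulIg.
  exact: fext_inj.
have phi_bij : bijective phi.
  by apply: inj_card_bij => //; rewrite card_prod !card_Sn card_ord factS.
rewrite {2}/antisym (reindex phi) /=; last exact: onW_bij.
rewrite -(pair_bigA _ (fun k t => (-1) ^+ phi (k, t) *: sgen F (phi (k, t)))) /=.
rewrite scalerA factS natrM invfM mulrA mulfV ?pnatr_eq0 // mul1r.
rewrite /antisym linearZ /= -scalerAr; congr (_ *: _).
rewrite [push _ _]linear_sum /= mulrBl mul1r mulr_suml big_ord_recl -sumrN; congr (_ + _).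
  apply: eq_bigr => t _; rewrite linearZ /= push_gen /phi /= tperm1 mulg1.
  by rewrite odd_fext_lift.
apply: eq_bigr => i _; rewrite mulr_sumr -sumrN; apply: eq_bigr => t _.
rewrite linearZ /= push_gen -scalerAr sgenM -scaleNr.
rewrite /phi /= odd_permM odd_tperm neq_lift addbT odd_fext_lift.
by rewrite signrN.
Qed.

End Antisymmetrizer.

(** * Rules for the trace *)

Section AuxMap.
Variables (n a b : nat) (h : 'I_a -> 'I_b).

(** Renames the auxiliary symbols and keeps 1, ..., n. *)
Definition aux_map (x : 'I_(n + a)) : 'I_(n + b) :=
  match split x with inl j => lshift b j | inr i => rshift n (h i) end.

Lemma aux_map_l j : aux_map (lshift a j) = lshift b j.
Proof. by rewrite /aux_map (unsplitK (inl j)). Qed.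

Lemma aux_map_r i : aux_map (rshift n i) = rshift n (h i).
Proof. by rewrite /aux_map (unsplitK (inr i)). Qed.

Lemma aux_map_inj : injective h -> injective aux_map.
Proof.
move=> h_inj x y; case: (split_ordP x) => i ->; case: (split_ordP y) => j ->;
  rewrite !(aux_map_l, aux_map_r).
- by move/lshift_inj->.
- by move/eqP; rewrite eq_lrshift.
- by move/eqP; rewrite eq_rlshift.
- by move/rshift_inj/h_inj->.
Qed.

Lemma map_aux_map : map aux_map (aux n a) = [seq rshift n i | i <- map h (enum 'I_a)].
Proof. by rewrite -!map_comp; apply: eq_map => i /=; rewrite aux_map_r. Qed.

Lemma aux_map_out i : i \notin codom h -> rshift n i \notin codom aux_map.
Proof.
apply: contra => /codomP[x]; case: (split_ordP x) => k ->.
  by rewrite aux_map_l => /eqP; rewrite eq_rlshift.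
by rewrite aux_map_r => /rshift_inj ->; apply: codom_f.
Qed.

End AuxMap.

Section TraceRules.
Variables (F : fieldType) (n : nat) (p : F).

Lemma push_lshift_aux a b (h : 'I_a -> 'I_b) (h_inj : injective h) (y : symalg F n) :
  push (aux_map_inj (n := n) h_inj) (push (@lshift_inj n a) y) = push (@lshift_inj n b) y.
Proof. by apply: push_comp => x /=; rewrite aux_map_l. Qed.

(** The two traces delete disjoint sets of symbols, so each deletion passes
    through the other factor. *)
Lemma Tr_merge a b c (h1 : 'I_a -> 'I_c) (h2 : 'I_b -> 'I_c)
    (h1_inj : injective h1) (h2_inj : injective h2)
    (y1 : symalg F (n + a)) (y2 : symalg F (n + b)) :
    perm_eq (map h1 (enum 'I_a) ++ map h2 (enum 'I_b)) (enum 'I_c) ->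
  Tr p y1 * Tr p y2 =
    Tr p (push (aux_map_inj h1_inj) y1 * push (aux_map_inj h2_inj) y2).
Proof.
move=> h12; apply: (push_inj (f_inj := @lshift_inj n c)).
rewrite rmorphM /= push_Tr -(push_lshift_aux h1_inj) -(push_lshift_aux h2_inj).
rewrite !push_Tr -!expects_push !map_aux_map.
set xs1 := map _ (map h1 _); set xs2 := map _ (map h2 _).
have -> : forall y, expects p (aux n c) y = expects p (xs1 ++ xs2) y.
  by move=> y; apply: expects_perm; rewrite -map_cat perm_sym; apply: perm_map.
have dis i : i \in map h2 (enum 'I_b) -> i \notin codom h1.
  move=> ih2; apply/codomP => -[j ij].
  have : uniq (map h1 (enum 'I_a) ++ map h2 (enum 'I_b)).
    by rewrite (perm_uniq h12) enum_uniq.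
  rewrite cat_uniq => /and3P[_ /hasPn/(_ i ih2)/negP nih1 _]; apply: nih1.
  by rewrite ij map_f // mem_enum.
rewrite -expectsMr ?expects_cat => [|x /mapP[i _ ->]]; last first.
  rewrite /xs2 -(map_aux_map n h2) expects_push -push_Tr push_lshift_aux.
  by apply/push_fixes/codomP => -[j /eqP]; rewrite eq_rlshift.
congr (expects _ _ _); rewrite expectsMl // => x /mapP[i ih2 ->].
by apply/push_fixes/aux_map_out/dis.
Qed.

Lemma vartheta_push m (x : symalg F m) : vartheta n x = push (@rshift_inj n m) x.
Proof.
apply: eq_bigr => s _; congr (_ *: sgen _ _); apply: fext_eq => [i|y].
  by rewrite permE /shift_fun (unsplitK (inr i)).
case: (split_ordP y) => j ->; last by rewrite codom_f.
by rewrite permE /shift_fun (unsplitK (inl j)).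
Qed.

Lemma Tr_cyc m (x : symalg F m) (y : symalg F (n + m)) :
  Tr p (push (@rshift_inj n m) x * y) = Tr p (y * push (@rshift_inj n m) x).
Proof.
apply: (push_inj (f_inj := @lshift_inj n m)); rewrite !push_Tr.
rewrite (sgen_sum x) linear_sum mulr_suml mulr_sumr !linear_sum; apply: eq_bigr => s _.
rewrite !linearZ /= -scalerAl -scalerAr !linearZ /=; congr (_ *: _).
rewrite push_gen expects_cyc // => [|x'].
  apply: uniq_perm.
  - by rewrite map_inj_uniq ?(map_inj_uniq (@rshift_inj n m)) ?enum_uniq //; apply: perm_inj.
  - by rewrite (map_inj_uniq (@rshift_inj n m)) enum_uniq.
  move=> z; apply/mapP/idP => [[w /mapP[i _ ->] ->]|/mapP[i _ ->]].
    by rewrite fextE aux_rshift.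
  by exists (rshift n (s^-1%g i)); rewrite ?aux_rshift // fextE permKV.
by case: (split_ordP x') => j ->; rewrite ?aux_rshift // => _; apply: fext_out;
   apply/codomP => -[i /eqP]; rewrite eq_lrshift.
Qed.

(** The first auxiliary symbol may be deleted before the others. *)
Lemma Tr_expect_first m (y : symalg F (n + m.+1)) (z : symalg F (n + m)) :
    expect p (rshift n ord0) y = push (aux_map_inj (@lift_inj m.+1 ord0)) z ->
  Tr p y = Tr p z.
Proof.
move=> yz; apply: (push_inj (f_inj := @lshift_inj n m.+1)); rewrite push_Tr.
rewrite -(push_lshift_aux (@lift_inj m.+1 ord0)) push_Tr -expects_push -yz map_aux_map.
rewrite -[expect p _ y]/(expects p [:: rshift n ord0] y) -expects_cat.
apply: expects_perm; rewrite perm_sym perm_catC /= /aux enum_ordSl /= -map_comp.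
by rewrite -map_comp.
Qed.

End TraceRules.

(** * Fusion *)

Section ProductRules.
Variable R : pzRingType.

Lemma prod_interleave n (U V : 'I_n -> R) :
    (forall i j, i != j -> GRing.comm (U i) (V j)) ->
  (\prod_i U i) * (\prod_i V i) = \prod_i (U i * V i).
Proof.
elim: n U V => [|n IHn] U V UV; first by rewrite !big_ord0 mulr1.
rewrite !big_ord_recl -IHn => [|i j ij]; last by apply: UV; rewrite (inj_eq lift_inj).
have comm0 : GRing.comm (V ord0) (\prod_(i < n) U (lift ord0 i)).
  by apply: commr_prod => i _; apply/commr_sym/UV; rewrite eq_sym neq_lift.
by rewrite -!mulrA; congr (_ * _); rewrite !mulrA comm0.
Qed.

Lemma prod_intertwine n (U V : 'I_n -> R) (c : R) :
  (forall i, c * U i = V i * c) -> c * (\prod_i U i) = (\prod_i V i) * c.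
Proof.
move=> cUV; elim/big_ind2: _ => [|u u' v v' cu cv|i _]; rewrite ?mulr1 ?mul1r //.
by rewrite mulrA cu -mulrA cv mulrA.
Qed.

End ProductRules.

Section Fusion.
Variables (F : numFieldType) (n : nat) (p : F).

(** The transposition of j and the auxiliary symbol k. *)
Definition swap m (j : 'I_n) (k : 'I_m) : symalg F (n + m) :=
  sgen F (tperm (lshift m j) (rshift n k)).
Definition jucys m j := \sum_(k < m) swap j k.
Definition monodromy m (a : F) := \prod_(j < n) (a%:A + jucys m (rev_ord j)).
(** The value of the transfer matrix at the scalar u = a. *)
Definition transfer m a := Tr p (vartheta n (antisym F m) * monodromy m a).

(** Conjugation by a permutation of the auxiliary symbols permutes the terms. *)
Lemma jucys_comm m j (x : symalg F m) : GRing.comm (push (@rshift_inj n m) x) (jucys m j).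
Proof.
rewrite (sgen_sum x) linear_sum; apply/commr_sym/commr_sum => s _.
rewrite linearZ /= /GRing.comm -scalerAl -scalerAr; congr (_ *: _).
rewrite push_gen /jucys mulr_suml mulr_sumr [RHS](reindex_inj (@perm_inj _ s^-1%g)) /=.
apply: eq_bigr => k _; rewrite /swap !sgenM; congr sgen.
rewrite [RHS]conjgC tpermJ fextE permKV fext_out //.
by apply/codomP => -[i /eqP]; rewrite eq_lrshift.
Qed.

Lemma swap_comm m j j' (k k' : 'I_m) : j != j' -> k != k' ->
  GRing.comm (swap j k) (swap j' k').
Proof.
move=> jj kk; apply: fixes_comm_tperm; apply: fixes_sgen;
  rewrite tpermD ?eq_lrshift ?eq_rlshift //.
by rewrite (inj_eq (@rshift_inj n m)).
Qed.

Lemma comm_affine (R : algType F) (b : F) (x y : R) :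
  GRing.comm x y -> GRing.comm x (b%:A + y).
Proof.
move=> xy; apply: commrD => //.
by rewrite /GRing.comm -scalerAl -scalerAr mulr1 mul1r.
Qed.

Lemma push_swap a b (h : 'I_a -> 'I_b) (h_inj : injective h) j k :
  push (aux_map_inj h_inj) (swap j k) = swap j (h k).
Proof. by rewrite push_gen fext_tperm aux_map_l aux_map_r. Qed.

Lemma push_monodromy a b (h : 'I_a -> 'I_b) (h_inj : injective h) x :
  push (aux_map_inj (n := n) h_inj) (monodromy a x) =
  \prod_(j < n) (x%:A + \sum_(i < a) swap (rev_ord j) (h i)).
Proof.
rewrite rmorph_prod; apply: eq_bigr => j _; rewrite rmorphD /= linearZ rmorph1 /=.
by congr (_ + _); rewrite /jucys linear_sum; apply: eq_bigr => i _; apply: push_swap.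
Qed.

(* The auxiliary symbol 0 belongs to the factor with one auxiliary symbol, the
   others to the factor with m of them.  Here e is the antisymmetrizer of
   1, ..., m and e' the one of 0, ..., m. *)
Section Step.
Variable m : nat.
Let push0 := push (F := F) (aux_map_inj (n := n) (@lift_inj m.+1 ord0)).
Let e := push0 (vartheta n (antisym F m)).
Let e' := vartheta n (antisym F m.+1).
Let s0 j : symalg F (n + m.+1) := swap j ord0.
Let sig j : symalg F (n + m.+1) := \sum_(i < m) swap j (lift ord0 i).
Let star : symalg F (n + m.+1) :=
  \sum_(i < m) sgen F (tperm (rshift n (lift ord0 i)) (rshift n ord0)).

Lemma jucys_split j : jucys m.+1 j = s0 j + sig j.
Proof. exact: big_ord_recl. Qed.

Lemma vartheta_antisym_tperm (k l : 'I_m.+1) : k != l ->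
  e' * sgen F (tperm (rshift n k) (rshift n l)) = - e' /\
  sgen F (tperm (rshift n k) (rshift n l)) * e' = - e'.
Proof.
move=> kl; rewrite /e' vartheta_push -(fext_tperm (@rshift_inj n m.+1)) -push_gen.
rewrite -!rmorphM /= antisymMr antisymMl odd_tperm kl expr1.
by rewrite scaleN1r linearN; split.
Qed.

Lemma e_push : e = push (@rshift_inj n m.+1) (push (@lift_inj m.+1 ord0) (antisym F m)).
Proof.
rewrite /e /push0 vartheta_push.
have g_inj := inj_comp (aux_map_inj (n:=n) (@lift_inj m.+1 ord0)) (@rshift_inj n m).
rewrite (push_comp _ _ g_inj) // (push_comp _ _ g_inj) // => i.
by rewrite /= aux_map_r.
Qed.

Lemma star_push : star = push (@rshift_inj n m.+1) (\sum_(i < m) sgen F (tperm ord0 (lift ord0 i))).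
Proof.
rewrite linear_sum; apply: eq_bigr => i _.
by rewrite /= push_gen fext_tperm [in RHS]tpermC.
Qed.

Lemma one_sub_star_e : (1 - star) * e = m.+1%:R *: e'.
Proof.
rewrite e_push star_push /e' vartheta_push -(rmorph1 (push (@rshift_inj n m.+1))).
rewrite -rmorphB -rmorphM antisym_rec; exact: linearZ.
Qed.

Lemma star_e' : star * e' = - (m%:R *: e').
Proof.
rewrite /star mulr_suml (eq_bigr (fun=> - e')) => [|i _].
  by rewrite sumr_const card_ord -scaler_nat scalerN.
by case: (vartheta_antisym_tperm (k := lift ord0 i) (l := ord0)); rewrite // eq_sym neq_lift.
Qed.

(** (1 - star) e and (1 - star) e' are the same multiple of e'. *)
Lemma star_diff : star * (e - e') = e - e'.
Proof.
have -> : star * (e - e') = e - m.+1%:R *: e' + m%:R *: e'.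
  by rewrite -one_sub_star_e mulrBl mul1r mulrBr star_e' opprK opprB addrCA subrr addr0.
by rewrite -[m.+1%:R]natr1 scalerDl scale1r opprD addrA addrAC subrK.
Qed.

Lemma sig_s0_left j : sig j * s0 j = \sum_(i < m)
  sgen F (tperm (rshift n (lift ord0 i)) (rshift n ord0)) * swap j (lift ord0 i).
Proof.
rewrite mulr_suml; apply: eq_bigr => i _; apply: sgen_tperm_mull; rewrite ?eq_lrshift //.
by rewrite (inj_eq (@rshift_inj n m.+1)) eq_sym neq_lift.
Qed.

Lemma sig_s0_right j : sig j * s0 j = s0 j * star.
Proof.
rewrite mulr_suml mulr_sumr; apply: eq_bigr => i _; apply: sgen_tperm_mulr; rewrite ?eq_lrshift //.
by rewrite (inj_eq (@rshift_inj n m.+1)) eq_sym neq_lift.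
Qed.

(** The quotient of the contribution of e - e' by a^n. *)
Definition transfer_rest a := Tr p (
  (e - e') * \prod_(j < n) ((a - 1)%:A + jucys m.+1 (rev_ord j))).

Theorem transfer_fusion a : transfer m (a - 1) * transfer 1 a =
  (a - 1) ^+ n *: transfer m.+1 a + a ^+ n *: transfer_rest a.
Proof.
pose h1 (i : 'I_1) : 'I_m.+1 := ord0.
have h1_inj : injective h1 by move=> i k _; rewrite !ord1.
pose Y j := ((a - 1)%:A + sig (rev_ord j)) * (a%:A + s0 (rev_ord j)).
have -> : transfer m (a - 1) * transfer 1 a = Tr p (e * \prod_(j < n) Y j).
  have th1 : vartheta n (antisym F 1) = 1 by rewrite antisym1 vartheta_push rmorph1.
  rewrite /transfer th1 mul1r (Tr_merge p (@lift_inj m.+1 ord0) h1_inj); last first.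
    have e0 : enum 'I_0 = [::] by apply/size0nil; rewrite size_enum_ord.
    by rewrite perm_catC !enum_ordSl e0.
  rewrite rmorphM /= !push_monodromy -mulrA prod_interleave => [|i j ij].
    by congr (Tr p (_ * _)); apply: eq_bigr => j _; rewrite big_ord1.
  apply/comm_affine/commr_sym/comm_affine.
  apply: commr_sum => k _; apply/commr_sym/commr_sum => k' _.
  by apply: swap_comm; rewrite ?(inj_eq rev_ord_inj) // eq_sym neq_lift.
(* The part e' of e is carried through all factors from left to right, the part
   e - e' from right to left. *)
have e'Y j : e' * Y j = ((a - 1) *: (a%:A + jucys m.+1 (rev_ord j))) * e'.
  rewrite /Y fusion_left; last first.
    rewrite sig_s0_left mulr_sumr /sig mulr_sumr -sumrN; apply: eq_bigr => i _.
    rewrite mulrA; case: (vartheta_antisym_tperm (k := lift ord0 i) (l := ord0)).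
      by rewrite eq_sym neq_lift.
    by move=> -> _; rewrite mulNr.
  rewrite -jucys_split -scalerAl; congr (_ *: _).
  by apply: comm_affine; rewrite /e' vartheta_push; apply: jucys_comm.
have Yd j : Y j * (e - e') = (e - e') * (a *: ((a - 1)%:A + jucys m.+1 (rev_ord j))).
  rewrite /Y fusion_right; last by rewrite mulrA sig_s0_right -mulrA star_diff.
  rewrite -jucys_split -scalerAr; congr (_ *: _).
  apply/esym/comm_affine; rewrite e_push /e' vartheta_push -rmorphB.
  exact: jucys_comm.
rewrite -[e](subrK e') mulrDl linearD /= addrC; congr (_ + _).
  rewrite (prod_intertwine e'Y) scaler_prod prodr_const card_ord -scalerAl linearZ /=.
  by rewrite /transfer /e' vartheta_push Tr_cyc.
have Yd' : (\prod_j Y j) * (e - e') =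
    (e - e') * \prod_(j < n) (a *: ((a - 1)%:A + jucys m.+1 (rev_ord j))).
  by elim/big_ind2: _ => [|u u' v v' uE vE|j _]; rewrite ?mulr1 ?mul1r // -mulrA vE mulrA uE mulrA.
have -> : Tr p ((e - e') * \prod_j Y j) = Tr p ((\prod_j Y j) * (e - e')).
  by rewrite e_push /e' vartheta_push -rmorphB Tr_cyc.
by rewrite Yd' scaler_prod prodr_const card_ord -scalerAr linearZ.
Qed.
Let c0 : 'I_(n + m.+1) := rshift n ord0.

Lemma e_fixes_c0 : fixes c0 e.
Proof.
by apply/push_fixes/aux_map_out/codomP => -[i /eqP]; rewrite (negPf (neq_lift _ _)).
Qed.

Lemma e_fixes_lshift j : fixes (lshift m.+1 j) e.
Proof.
by rewrite e_push; apply/push_fixes/codomP => -[i /eqP]; rewrite eq_lrshift.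
Qed.

Lemma expect_one_sub_star : expect p c0 (1 - star) = (p - m%:R)%:A.
Proof.
have -> : expect p c0 (1 - star) = expect p c0 (sgen F 1%g) - expect p c0 star.
  by rewrite linearB.
have -> : expect p c0 star = m%:R%:A.
  rewrite [expect p c0 star]linear_sum (eq_bigr (fun=> 1)) => [|i _] /=.
    by rewrite sumr_const card_ord scaler_nat.
  rewrite expect_gen tpermR (inj_eq (@rshift_inj n m.+1)) eq_sym.
  by rewrite (negPf (neq_lift _ _)) scale1r /delp tpermR tpermC tperm2 sgen1.
by rewrite expect_gen perm1 eqxx expr1 delp_idl ?perm1 // sgen1 scalerBl.
Qed.

(** Deleting the symbol 0 from (1 - star) e leaves (p - m) e, as the m
    transpositions of star disappear and 1 gives a factor p. *)
Lemma Tr_antisym_rec :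
  m.+1%:R *: Tr p (vartheta n (antisym F m.+1)) =
  (p - m%:R) *: Tr p (vartheta n (antisym F m)).
Proof.
rewrite -!linearZ /= -one_sub_star_e; apply: Tr_expect_first.
rewrite expectMr ?expect_one_sub_star; last exact: e_fixes_c0.
by rewrite -scalerAl mul1r linearZ.
Qed.

Lemma Tr_antisym_swap j (k : 'I_m.+1) : Tr p (e' * swap j k) = Tr p (e' * s0 j).
Proof.
have [->//|k0] := eqVneq k ord0.
pose s := sgen F (tperm (rshift n k) (rshift n ord0)).
have sE : s = push (@rshift_inj n m.+1) (sgen F (tperm k ord0)).
  by rewrite push_gen fext_tperm.
have [e's se'] := vartheta_antisym_tperm k0.
have -> : swap j k = s * s0 j * s.
  rewrite !sgenM; congr sgen; rewrite mulgA -[X in _ = (X * _ * _)%g]tpermV.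
  rewrite -mulgA -conjgE.
  by rewrite tpermJ tpermR tpermD ?eq_rlshift // tpermC.
by rewrite !mulrA e's {1}sE -Tr_cyc -sE mulNr mulrN mulrA se' mulNr opprK.
Qed.

Lemma expect_star_s0 j : expect p c0 ((1 - star) * s0 j) = 1 - sig j.
Proof.
rewrite mulrBl mul1r linearB /=; congr (_ - _).
  rewrite expect_gen tpermR eq_lrshift scale1r.
  by rewrite /delp tpermR tpermC tperm2 sgen1.
rewrite mulr_suml linear_sum; apply: eq_bigr => i _ /=.
have i0 : rshift n (lift ord0 i) != c0.
  by rewrite (inj_eq (@rshift_inj n m.+1)) eq_sym neq_lift.
rewrite sgenM expect_gen permM tpermR tpermD ?eq_rlshift //.
rewrite eq_lrshift scale1r; congr sgen.
rewrite /delp permM tpermR tpermD ?eq_rlshift //.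
rewrite [tperm c0 _]tpermC -[X in (X * _ * _)%g]tpermV -mulgA -conjgE.
by rewrite tpermJ tpermR tpermD ?eq_lrshift 1?eq_sym // tpermC.
Qed.

(** By symmetry the sum over the auxiliary symbols is m + 1 times its term for
    the symbol 0; deleting 0 from (1 - star) s_(j,0) leaves 1 minus the sum of
    the s_(j,i) with i > 0. *)
Lemma Tr_antisym_jucys_rec j :
  Tr p (vartheta n (antisym F m.+1) * jucys m.+1 j) =
  Tr p (vartheta n (antisym F m)) - Tr p (vartheta n (antisym F m) * jucys m j).
Proof.
rewrite -/e' /jucys mulr_sumr linear_sum (eq_bigr (fun=> Tr p (e' * s0 j))) => [|k _]; last first.
  exact: Tr_antisym_swap.
rewrite sumr_const card_ord -scaler_nat -linearZ /= scalerAl -one_sub_star_e -mulrA.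
rewrite (fixes_comm_tperm (e_fixes_lshift j) e_fixes_c0) mulrA -linearB.
apply: Tr_expect_first; rewrite expectMr ?expect_star_s0; last exact: e_fixes_c0.
rewrite vartheta_push (jucys_comm j (antisym F m)) -vartheta_push.
rewrite (_ : _ - _ = (1 - jucys m j) * vartheta n (antisym F m)); last first.
  by rewrite mulrBl mul1r.
rewrite rmorphM rmorphB rmorph1; congr ((_ - _) * _).
by rewrite [RHS]linear_sum; apply: eq_bigr => i _; symmetry; apply: push_swap.
Qed.

End Step.

End Fusion.

(** * Transfer matrices as polynomials *)

Section ScalarEvaluation.
Variables (F : numFieldType) (R : algType F).
Implicit Types (P Q : {poly R}) (a : F).

Lemma scalar_exp a i : (a%:A : R) ^+ i = (a ^+ i)%:A.
Proof. by rewrite exprZn expr1n. Qed.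

Lemma comm_scalar (x : R) a : GRing.comm x a%:A.
Proof. by rewrite /GRing.comm -scalerAl -scalerAr mulr1 mul1r. Qed.

Lemma horner_scalar P a : P.[a%:A] = \sum_(i < size P) a ^+ i *: P`_i.
Proof.
rewrite horner_coef; apply: eq_bigr => i _.
by rewrite scalar_exp -scalerAr mulr1.
Qed.

Lemma hornerM_scalar P Q a : (P * Q).[a%:A] = P.[a%:A] * Q.[a%:A].
Proof. by rewrite hornerM_comm //; apply/commr_sym/comm_scalar. Qed.

Lemma horner_prod_scalar (I : Type) (r : seq I) (f : I -> {poly R}) a :
  (\prod_(i <- r) f i).[a%:A] = \prod_(i <- r) (f i).[a%:A].
Proof.
elim: r => [|i r IHr]; first by rewrite !big_nil hornerC.
by rewrite !big_cons hornerM_scalar IHr.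
Qed.

Lemma horner_exp_scalar P a i : (P ^+ i).[a%:A] = P.[a%:A] ^+ i.
Proof.
elim: i => [|i IHi]; first by rewrite !expr0 hornerC.
by rewrite !exprS hornerM_scalar IHi.
Qed.

Lemma horner_comp_Xsub1 P a : (P \Po ('X - 1)).[a%:A] = P.[(a - 1)%:A].
Proof.
rewrite comp_polyE horner_sum horner_coef; apply: eq_bigr => i _.
rewrite hornerZ horner_exp_scalar hornerD hornerN hornerX hornerC.
by rewrite scalerBl scale1r.
Qed.

End ScalarEvaluation.

(** Coordinatewise, a polynomial over an infinite field is determined by its
    values; evaluation at scalars is multiplicative, unlike evaluation at other
    elements of a noncommutative algebra. *)
Lemma scalar_eval_inj (F : numFieldType) N (P Q : {poly symalg F N}) :
  (forall a : F, P.[a%:A] = Q.[a%:A]) -> P = Q.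
Proof.
move=> PQ; apply/eqP; rewrite -subr_eq0; apply/eqP; set D := P - Q.
have D0 a : D.[a%:A] = 0 by rewrite hornerD hornerN PQ subrr.
apply/polyP => i; rewrite coef0; apply/ffunP => s; rewrite [RHS]ffunE.
pose d : {poly F} := \poly_(i < size D) (D`_i s).
have d0 : d = 0.
  apply/eqP; apply: contraT => nz_d.
  pose rs : seq F := [seq k%:R | k <- iota 0 (size D)].
  have urs : uniq rs by rewrite map_inj_uniq ?iota_uniq // => j k /eqP; rewrite eqr_nat => /eqP.
  have /(max_poly_roots nz_d)/(_ urs) : all (root d) rs.
    apply/allP => a _; rewrite /root horner_poly.
    have := D0 a; rewrite horner_scalar => /ffunP/(_ s); rewrite sum_ffunE [RHS]ffunE => Da.
    apply/eqP; rewrite -[RHS]Da; apply: eq_bigr => j _.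
    by rewrite ffunE mulrC.
  by rewrite size_map size_iota ltnNge size_poly.
have := congr1 (fun f : {poly F} => f`_i) d0; rewrite coef_poly coef0.
by case: ltnP => // le_i _; rewrite nth_default // ffunE.
Qed.

Lemma coef_prod_affine (R : nzRingType) n (c : 'I_n -> R) (P : {poly R}) :
  P = \prod_(j < n) ('X + (c j)%:P) ->
  [/\ (size P <= n.+1)%N, P`_n = 1 & (0 < n)%N -> P`_n.-1 = \sum_j c j].
Proof.
move=> ->; elim: n c {P} => [|n IHn] c.
  by rewrite big_ord0 size_poly1 coef1.
rewrite big_ord_recl; set Q := \prod_(i < n) _.
have [szQ Qn Qn1] : [/\ (size Q <= n.+1)%N, Q`_n = 1 &
    (0 < n)%N -> Q`_n.-1 = \sum_j c (lift ord0 j)] by apply: IHn.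
have coefP i : (('X + (c ord0)%:P) * Q)`_i.+1 = Q`_i + c ord0 * Q`_i.+1.
  by rewrite mulrDl coefD coefXM coefCM.
split.
- apply/leq_sizeP => -[//|i] le_ni; have szi : (size Q <= i)%N by apply: leq_trans szQ _.
  by rewrite coefP !nth_default ?mulr0 ?addr0 // leqW.
- by rewrite coefP Qn nth_default ?mulr0 ?addr0.
move=> _ /=; rewrite big_ord_recl [RHS]addrC.
case: n c @Q szQ Qn Qn1 coefP {IHn} => [|k] c Q szQ Qn Qn1 coefP.
  by rewrite /Q !big_ord0 add0r mulr1 coefD coefX coefC add0r.
by rewrite coefP Qn1 // Qn mulr1.
Qed.

Section TransferPolynomial.
Variables (F : numFieldType) (n : nat) (p : F).

Lemma Tr0 : Tr p (1 : symalg F (n + 0)) = 1 :> symalg F n.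
Proof.
apply: (push_inj (f_inj := @lshift_inj n 0)); rewrite push_Tr rmorph1.
by rewrite (size0nil (s := aux n 0)) // size_map size_enum_ord.
Qed.

Lemma map_Tr_horner m (P : {poly symalg F (n + m)}) a :
  (map_poly (@Tr F n m p) P).[a%:A] = Tr p P.[a%:A].
Proof.
rewrite (@horner_coef_wide _ (size P)) ?size_poly // horner_scalar linear_sum.
apply: eq_bigr => i _; rewrite coef_map_id0 ?linear0 // scalar_exp -scalerAr mulr1.
by rewrite linearZ.
Qed.

Lemma TpolyE m : Tpoly n m p = map_poly (@Tr F n m p)
  ((vartheta n (antisym F m))%:P * \prod_(j < n) ('X + (jucys F m (rev_ord j))%:P)).
Proof.
rewrite /Tpoly; case: m => [|m] //=.
have -> : vartheta n (antisym F 0) = 1.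
  rewrite vartheta_push (_ : antisym F 0 = 1) ?rmorph1 //.
  rewrite /antisym invr1 scale1r (eq_bigr (fun=> 1)) ?sumr_const ?card_Sn // => s _.
  have -> : s = 1%g by apply/permP => -[].
  by rewrite odd_perm1 scale1r sgen1.
rewrite mul1r (eq_bigr (fun=> 'X)) => [|j _]; last by rewrite /jucys big_ord0 addr0.
rewrite prodr_const card_ord; apply/polyP => i.
rewrite coef_map_id0 ?linear0 // !coefXn; case: eqP => _; last by rewrite linear0.
by rewrite Tr0.
Qed.

Lemma Tpoly_horner m a : (Tpoly n m p).[a%:A] = transfer n p m a.
Proof.
rewrite TpolyE map_Tr_horner hornerM_scalar hornerC horner_prod_scalar.
congr (Tr p (_ * _)); apply: eq_bigr => j _.
by rewrite hornerD hornerX hornerC.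
Qed.

Lemma size_Tpoly m : (size (Tpoly n m p) <= n.+1)%N.
Proof.
rewrite TpolyE; apply/leq_sizeP => i le_ni; rewrite coef_map_id0 ?linear0 //.
rewrite coefCM nth_default ?mulr0 ?linear0 //.
have [sz _ _] := coef_prod_affine (c := fun j : 'I_n => jucys F m (rev_ord j)) erefl.
exact: (leq_trans sz).
Qed.

Lemma Tpoly_top m : (Tpoly n m p)`_n = Tr p (vartheta n (antisym F m)).
Proof.
rewrite TpolyE coef_map_id0 ?linear0 // coefCM.
by have [_ -> _] := coef_prod_affine (c := fun j : 'I_n => jucys F m (rev_ord j)) erefl; rewrite mulr1.
Qed.

Lemma Tpoly_sub m : (0 < n)%N ->
  (Tpoly n m p)`_n.-1 = \sum_(j < n) Tr p (vartheta n (antisym F m) * jucys F m j).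
Proof.
move=> n_gt0; rewrite TpolyE coef_map_id0 ?linear0 // coefCM.
have [_ _ ->//] := coef_prod_affine (c := fun j : 'I_n => jucys F m (rev_ord j)) erefl.
by rewrite mulr_sumr linear_sum (reindex_inj rev_ord_inj); apply: eq_bigr => j _; rewrite /= rev_ordK.
Qed.

Lemma Tpoly_top0 : (Tpoly n 0 p)`_n = 1.
Proof. by rewrite /Tpoly /= coefXn eqxx. Qed.

Lemma Tpoly_top_rec m :
  m.+1%:R *: (Tpoly n m.+1 p)`_n = (p - m%:R) *: (Tpoly n m p)`_n.
Proof. by rewrite !Tpoly_top Tr_antisym_rec. Qed.

Lemma Tpoly_sub_rec m : (0 < n)%N ->
  (Tpoly n m.+1 p)`_n.-1 = (Tpoly n m p)`_n *+ n - (Tpoly n m p)`_n.-1.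
Proof.
move=> n_gt0; rewrite !Tpoly_sub // Tpoly_top.
rewrite (eq_bigr _ (fun j _ => Tr_antisym_jucys_rec p m j)) sumrB.
by rewrite sumr_const card_ord.
Qed.

Lemma Tpoly_sub0 : (0 < n)%N -> (Tpoly n 0 p)`_n.-1 = 0.
Proof.
by case: n => // k _; rewrite /Tpoly /= coefXn eqn_leq ltnn andbF.
Qed.

(** [transfer_fusion] holds at all scalars, hence for polynomials, and its last
    term is a multiple of X^n. *)
Theorem Tpoly_fusion m :
  eqmodX n (('X - 1) ^+ n * Tpoly n m.+1 p) ((Tpoly n m p \Po ('X - 1)) * Tpoly n 1 p).
Proof.
pose d := push (aux_map_inj (n := n) (@lift_inj m.+1 ord0)) (vartheta n (antisym F m))
  - vartheta n (antisym F m.+1).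
pose U := map_poly (@Tr F n m.+1 p)
  (d%:P * \prod_(j < n) ('X + (jucys F m.+1 (rev_ord j) - 1)%:P)).
have -> : (Tpoly n m p \Po ('X - 1)) * Tpoly n 1 p =
    ('X - 1) ^+ n * Tpoly n m.+1 p + 'X^n * U.
  apply: scalar_eval_inj => a.
  rewrite hornerD !hornerM_scalar horner_comp_Xsub1 !Tpoly_horner transfer_fusion.
  rewrite !horner_exp_scalar hornerX hornerD hornerN hornerX hornerC.
  have -> : a%:A - 1 = (a - 1)%:A :> symalg F n by rewrite scalerBl scale1r.
  rewrite !scalar_exp -!scalerAl !mul1r.
  congr (_ + _ *: _); rewrite map_Tr_horner hornerM_scalar hornerC horner_prod_scalar.
  congr (Tr p (_ * _)); apply: eq_bigr => j _.
  by rewrite hornerD hornerX hornerC scalerBl scale1r addrA addrAC.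
by move=> i lt_in; rewrite coefD (eqmodX_Xn _ lt_in) coef0 addr0.
Qed.

(** With r = a - b + s and r' = a - b - s, where s exchanges the two auxiliary
    symbols, r intertwines the two orders of the factors and r' r = r r' is the
    scalar (a - b)^2 - 1.  Cyclicity moves r to the other side. *)
Lemma transfer1_comm a b : ((a - b) ^+ 2 - 1) *:
  (transfer n p 1 a * transfer n p 1 b - transfer n p 1 b * transfer n p 1 a) = 0 :> symalg F n.
Proof.
pose h1 (i : 'I_1) : 'I_2 := ord0; pose h2 (i : 'I_1) : 'I_2 := ord_max.
have h1_inj : injective h1 by move=> i k _; rewrite !ord1.
have h2_inj : injective h2 by move=> i k _; rewrite !ord1.
have th1 : vartheta n (antisym F 1) = 1 by rewrite antisym1 vartheta_push rmorph1.
pose x j : symalg F (n + 2) := swap F (rev_ord j) ord0.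
pose y j : symalg F (n + 2) := swap F (rev_ord j) ord_max.
pose s : symalg F (n + 2) := sgen F (tperm (rshift n ord0) (rshift n ord_max)).
have e0 : enum 'I_0 = [::] by apply/size0nil; rewrite size_enum_ord.
have e1 : map h1 (enum 'I_1) = [:: ord0] by rewrite enum_ordSl e0.
have e2 : map h2 (enum 'I_1) = [:: ord_max] by rewrite enum_ordSl e0.
have e12 : enum 'I_2 = [:: ord0; ord_max].
  by rewrite !enum_ordSl e0 /=; congr [:: _; _]; apply: val_inj.
have commxy i j : i != j -> GRing.comm (a%:A + x i) (b%:A + y j).
  move=> ij; apply/comm_affine/commr_sym/comm_affine/commr_sym.
  by apply: swap_comm; rewrite ?(inj_eq rev_ord_inj).
have -> : transfer n p 1 a * transfer n p 1 b = Tr p (\prod_(j < n) ((a%:A + x j) * (b%:A + y j))).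
  rewrite /transfer th1 !mul1r (Tr_merge p h1_inj h2_inj) ?e1 ?e2 ?e12 //.
  rewrite !push_monodromy -prod_interleave //.
  by congr (Tr p (_ * _)); apply: eq_bigr => j _; rewrite big_ord1.
have -> : transfer n p 1 b * transfer n p 1 a = Tr p (\prod_(j < n) ((b%:A + y j) * (a%:A + x j))).
  rewrite /transfer th1 !mul1r (Tr_merge p h2_inj h1_inj) ?e1 ?e2 ?e12 //.
  rewrite !push_monodromy -prod_interleave => [|i j ij]; last first.
    by apply/commr_sym/commxy; rewrite eq_sym.
  by congr (Tr p (_ * _)); apply: eq_bigr => j _; rewrite big_ord1.
pose r := (a - b)%:A + s; pose r' := (a - b)%:A - s.
have ss : s * s = 1 by apply: sgen_tperm2.
have rr' : r * r' = ((a - b) ^+ 2 - 1)%:A /\ r' * r = ((a - b) ^+ 2 - 1)%:A.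
  rewrite /r /r' !mul_affine scalerN subrK addrK mulrN mulNr ss.
  by rewrite scalerBl scale1r expr2.
have rY j : r * ((a%:A + x j) * (b%:A + y j)) = ((b%:A + y j) * (a%:A + x j)) * r.
  have neq1 : lshift 2 (rev_ord j) != rshift n ord0 by rewrite eq_lrshift.
  have neq2 : lshift 2 (rev_ord j) != rshift n ord_max by rewrite eq_lrshift.
  have neq3 : rshift n (ord0 : 'I_2) != rshift n ord_max.
    by rewrite (inj_eq (@rshift_inj n 2)).
  apply: yang_baxter => //.
  - exact: sgen_tperm_mull.
  - exact: sgen_tperm_mulr.
  - by rewrite /s tpermC; apply: sgen_tperm_mull; rewrite // eq_sym.
  - by rewrite /s tpermC; apply: sgen_tperm_mulr; rewrite // eq_sym.
have sE : s = push (@rshift_inj n 2) (sgen F (tperm ord0 ord_max)).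
  by rewrite push_gen fext_tperm.
have rE : r = push (@rshift_inj n 2) ((a - b)%:A + sgen F (tperm ord0 ord_max)).
  by rewrite rmorphD /= linearZ rmorph1 /= -sE.
have [rr1 rr2] := rr'; set L := \prod_j _; set L' := \prod_j _.
have rL : r * L = L' * r by apply: prod_intertwine.
have -> : Tr p L - Tr p L' = Tr p (L - L') by rewrite linearB.
rewrite -linearZ scalerBr linearB /=.
have -> : ((a - b) ^+ 2 - 1) *: L = r' * (L' * r).
  by rewrite -rL mulrA rr2 -scalerAl mul1r.
have -> : ((a - b) ^+ 2 - 1) *: L' = r * (r' * L').
  by rewrite mulrA rr1 -scalerAl mul1r.
by rewrite mulrA {1}rE -Tr_cyc -rE subrr.
Qed.

(** The factor (a - b)^2 - 1 is cancelled as a monic polynomial in a. *)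
Lemma Tpoly1_comm i j : GRing.comm (Tpoly n 1 p)`_i (Tpoly n 1 p)`_j.
Proof.
pose T := Tpoly n 1 p.
have commTb b : T * T.[b%:A]%:P = T.[b%:A]%:P * T.
  apply/eqP; rewrite -subr_eq0; apply/eqP; set D := _ - _.
  have /monic_lreg/mulrI_eq0 regX : ('X - (b + 1)%:A%:P) * ('X - (b - 1)%:A%:P) \is @monic (symalg F n).
    by rewrite monicMl ?monicXsubC.
  apply/eqP; rewrite -regX; apply/eqP/scalar_eval_inj => a.
  rewrite !hornerM_scalar !hornerXsubC horner0 -!scalerBl -scalerAl mul1r scalerA.
  rewrite -scalerAl mul1r /D hornerD hornerN !hornerM_scalar hornerC !Tpoly_horner.
  rewrite -[RHS](transfer1_comm a b); congr (_ *: _).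
  by ring.
have TiT : (T`_i)%:P * T = T * (T`_i)%:P.
  apply: scalar_eval_inj => b; rewrite !hornerM_scalar hornerC.
  by have := congr1 (fun P : {poly symalg F n} => P`_i) (commTb b); rewrite coefMC coefCM.
by have := congr1 (fun P : {poly symalg F n} => P`_j) TiT; rewrite coefMC coefCM.
Qed.

End TransferPolynomial.

(** * The first transfer matrix *)

Section FirstTransfer.
Variables (F : numFieldType) (n : nat) (p : F).
Implicit Types (l : seq 'I_n) (B : {set 'I_n}).

Definition cycle_elt l : symalg F n :=
  \prod_(ab <- zip l (behead l)) sgen F (tperm ab.1 ab.2).

Lemma Tr_mull m (z : symalg F n) (y : symalg F (n + m)) :
  Tr p (push (@lshift_inj n m) z * y) = z * Tr p y.
Proof.
apply: (push_inj (f_inj := @lshift_inj n m)); rewrite rmorphM /= !push_Tr.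
rewrite expectsMl // => x /mapP[i _ ->]; apply/push_fixes/codomP => -[j /eqP].
by rewrite eq_rlshift.
Qed.

(** For the first two symbols j and k of l, s_(k,0) s_(j,0) = s_(j,k) s_(k,0), and
    the factor s_(j,k) commutes with what stands to its left, so it can be
    taken out of the trace. *)
Lemma Tr_swap_prod l : uniq l ->
  Tr p (\prod_(k <- rev l) swap F k (ord0 : 'I_1)) =
  if l is [::] then p%:A else cycle_elt l.
Proof.
have aux1 : aux n 1 = [:: rshift n ord0].
  by rewrite /aux enum_ordSl (size0nil (s := enum 'I_0)) // size_enum_ord.
have Tr1 y z : expect p (rshift n ord0) y = push (@lshift_inj n 1) z -> Tr p y = z.
  move=> yz; apply: (push_inj (f_inj := @lshift_inj n 1)).
  by rewrite push_Tr aux1 /= yz.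
case: l => [|j l] ul.
  apply: Tr1; rewrite big_nil -sgen1 expect_gen perm1 eqxx expr1 delp_idl ?perm1 //.
  by rewrite linearZ rmorph1.
elim: l j ul => [|k l IHl] j.
  move=> _; apply: Tr1; rewrite /cycle_elt !big_nil rmorph1 big_seq1 expect_gen tpermR.
  by rewrite eq_lrshift scale1r /delp tpermR tpermC tperm2 sgen1.
rewrite cons_uniq => /andP[jkl kl_uniq].
rewrite [cycle_elt (j :: _)]/cycle_elt big_cons -/(cycle_elt (k :: l)) -(IHl k kl_uniq) -Tr_mull.
congr (Tr p _); rewrite push_gen fext_tperm !rev_cons -!cats1 !big_cat !big_seq1 /=.
set Q := \prod_(i <- rev l) _; set s := sgen F _.
have jk : j != k by move: jkl; rewrite inE negb_or => /andP[].
have commQ : GRing.comm s Q.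
  rewrite /Q big_seq; apply: commr_prod => i; rewrite mem_rev => il.
  apply/commr_sym/fixes_comm_tperm; apply: fixes_sgen.
    rewrite tpermD ?eq_rlshift // (inj_eq (@lshift_inj n 1)).
    by apply: contraNneq jkl => <-; rewrite inE il orbT.
  rewrite tpermD ?eq_rlshift // (inj_eq (@lshift_inj n 1)).
  by move: kl_uniq => /= /andP[kl _]; apply: contraNneq kl => <-.
rewrite mulrA commQ -!mulrA; congr (Q * _).
rewrite /swap [tperm (lshift 1 k) _]tpermC [tperm (lshift 1 j) (rshift _ _)]tpermC.
rewrite sgen_tperm_mull ?eq_rlshift //; last first.
  by rewrite (inj_eq (@lshift_inj n 1)) eq_sym.
by rewrite /s tpermC.
Qed.

(** The increasing list of the symbols that are selected by B in the product
    defining the transfer matrix, whose factor number j belongs to the symbol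
    rev_ord j. *)
Definition rev_enum B : seq 'I_n := rev (map (@rev_ord n) (enum B)).

Lemma rev_enum_uniq B : uniq (rev_enum B).
Proof. by rewrite rev_uniq (map_inj_uniq rev_ord_inj) enum_uniq. Qed.

Lemma mem_rev_enum B x : (x \in rev_enum B) = (rev_ord x \in B).
Proof.
rewrite mem_rev -{1}(rev_ordK x) (mem_map rev_ord_inj).
by rewrite mem_enum.
Qed.

Lemma size_rev_enum B : size (rev_enum B) = #|B|.
Proof. by rewrite size_rev size_map cardE. Qed.

Lemma sorted_rev_enum B : sorted ltn (map val (rev_enum B)).
Proof.
rewrite sorted_map /rev_enum rev_sorted sorted_map.
have : sorted (relpre val ltn) (enum B).
  rewrite /enum_mem; apply: sorted_filter; first by move=> x y z; apply: ltn_trans.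
  by rewrite -sorted_map -enumT val_enum_ord iota_ltn_sorted.
apply: sub_sorted => x y /= lt_xy; have := ltn_ord x; have := ltn_ord y.
lia.
Qed.

Lemma GsumE k : Gsum F n k = \sum_(B : {set 'I_n} | #|B| == k) cycle_elt (rev_enum B).
Proof.
have ltn_tr : transitive (relpre val ltn : rel 'I_n) by move=> y x z; apply: ltn_trans.
have irr : irreflexive (relpre val ltn : rel 'I_n) by move=> x; apply: ltnn.
have setE l B : sorted ltn (map val l) -> ([set x | rev_ord x \in l] == B) = (l == rev_enum B).
  move=> sl; apply/eqP/eqP => [<-|->].
    apply: (irr_sorted_eq ltn_tr irr); rewrite -?sorted_map ?sorted_rev_enum // => x.
    by rewrite mem_rev_enum inE rev_ordK.
  by apply/setP => x; rewrite inE mem_rev_enum rev_ordK.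
rewrite /Gsum (partition_big (fun t : k.-tuple 'I_n => [set x | rev_ord x \in t])
  (fun B : {set 'I_n} => #|B| == k)) /= => [|t sorted_t]; last first.
  have := setE t _ sorted_t; move/(_ [set x | rev_ord x \in tval t]); rewrite eqxx => /esym/eqP tE.
  by rewrite -size_rev_enum -tE size_tuple.
apply: eq_bigr => B /eqP cardB.
have szB : size (rev_enum B) == k by rewrite size_rev_enum cardB.
rewrite (big_pred1 (Tuple szB)) // => t /=.
have [sorted_t|] := boolP (sorted _ _); first by rewrite /= setE.
by move=> nsorted; apply/esym/negbTE; apply: contra nsorted => /eqP ->; apply: sorted_rev_enum.
Qed.

Lemma prod_affine_expand (R : nzRingType) (c : 'I_n -> R) :
  \prod_(j < n) ('X + (c j)%:P) =
  \sum_(B : {set 'I_n}) (\prod_(j <- enum B) c j)%:P * 'X^(n - #|B|).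
Proof.
under eq_bigr => j _ do rewrite addrC.
rewrite bigA_distr; apply: eq_bigr => B _.
have expand (r : seq 'I_n) : \prod_(j <- r) (if j \in B then (c j)%:P else 'X) =
    (\prod_(j <- r | j \in B) c j)%:P * 'X^(count [predC B] r).
  elim: r => [|j r IHr]; first by rewrite !big_nil mul1r.
  rewrite !big_cons IHr /=; case: (j \in B) => /=; first by rewrite polyCM mulrA.
  by rewrite mulrA -commr_polyX -mulrA -exprS.
have -> : enum B = filter (mem B) (index_enum _) by rewrite [index_enum _]unlock.
rewrite expand big_filter; congr (_ * 'X^_).
have cardB := cardC (mem B); rewrite card_ord in cardB.
apply/eqP; rewrite -(eqn_add2l #|B|) subnKC; last first.
  by rewrite -[X in (_ <= X)%N]cardB leq_addr.
rewrite -[X in _ == X]cardB eqn_add2l -sum1_count sum1_card.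
by apply/eqP/eq_card => j; rewrite !inE.
Qed.

Lemma Gsum1 : Gsum F n 1 = n%:R.
Proof.
rewrite GsumE (eq_bigr (fun=> 1)) => [|B cardB].
  rewrite sumr_const; transitivity (1 *+ #|[set B : {set 'I_n} | #|B| == 1%N]| : symalg F n).
    by congr (_ *+ _); apply: eq_card => B; rewrite !inE.
  by rewrite card_draws card_ord bin1.
rewrite /cycle_elt; have : size (rev_enum B) = 1%N by rewrite size_rev_enum; apply/eqP.
by case: (rev_enum B) => [|x [|y l]] //= _; rewrite big_nil.
Qed.

Lemma Tpoly1_sum : Tpoly n 1 p =
  p%:A *: 'X^n + \sum_(i < n) Gsum F n i.+1 *: 'X^(n - i.+1).
Proof.
rewrite TpolyE antisym1 vartheta_push rmorph1 mul1r.
rewrite (eq_bigr (fun j => 'X + (swap F (rev_ord j) (ord0 : 'I_1))%:P)); last first.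
  by move=> j _; rewrite /jucys big_ord1.
rewrite prod_affine_expand.
pose h B := if #|B| == 0%N then p%:A else cycle_elt (rev_enum B).
have -> : map_poly (@Tr F n 1 p) (\sum_(B : {set 'I_n})
    (\prod_(j <- enum B) swap F (rev_ord j) (ord0 : 'I_1))%:P * 'X^(n - #|B|)) =
  \sum_(B : {set 'I_n}) (h B)%:P * 'X^(n - #|B|).
  apply/polyP => i; rewrite coef_map_id0 ?linear0 // !coef_sum linear_sum.
  apply: eq_bigr => B _; rewrite /= !coefCM !coefXn.
  case: eqP => _; last by rewrite !mulr0 linear0.
  rewrite !mulr1 /h -size_rev_enum -(big_map (@rev_ord n) xpredT (fun k => swap F k (ord0 : 'I_1))).
  rewrite -[map _ _]revK -/(rev_enum B) Tr_swap_prod ?rev_enum_uniq //.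
  by case: (rev_enum B).
have cardB_lt B : (#|B| < n.+1)%N by rewrite ltnS -[n in (_ <= n)%N]card_ord max_card.
rewrite (partition_big (fun B : {set 'I_n} => Ordinal (cardB_lt B)) xpredT) //=.
have hG (k : 'I_n.+1) : k != ord0 ->
    \sum_(B : {set 'I_n} | Ordinal (cardB_lt B) == k) (h B)%:P * 'X^(n - #|B|) =
    Gsum F n k *: 'X^(n - k).
  move=> k0; rewrite -mul_polyC GsumE rmorph_sum mulr_suml.
  apply: eq_big => [B|B /eqP kE]; first by rewrite -val_eqE.
  have kE' : #|B| = k := congr1 val kE.
  by rewrite /h kE'; move: k0; rewrite -val_eqE => /negPf /= ->.
rewrite big_ord_recl (big_pred1 set0) => [|B]; last first.
  by rewrite -val_eqE /= cards_eq0.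
rewrite /h cards0 eqxx subn0 mul_polyC; congr (_ + _).
by apply: eq_bigr => i _; apply: hG.
Qed.

End FirstTransfer.

Lemma S1E (F : numFieldType) n :
  S1 F n = \sum_(i < n) Gsum F n i.+1 *: 'X^(n - i.+1).
Proof.
rewrite /S1; case: n => [|n]; first by rewrite big_ord0 big_geq // mulr0n addr0.
rewrite big_ord_recl Gsum1 subSS subn0 scaler_nat; congr (_ + _).
by rewrite 2!big_add1 big_mkord; apply: eq_bigr => i _.
Qed.

Theorem Tpoly1E (F : numFieldType) n (p : F) : Tpoly n 1 p = p%:A *: 'X^n + S1 F n.
Proof. by rewrite Tpoly1_sum S1E. Qed.

(** For p = 1 the value of T_1 at 0 is the trace of a single permutation. *)
Lemma S1_coef0 (F : numFieldType) n : (0 < n)%N -> exists t, (S1 F n)`_0 = sgen F t.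
Proof.
move=> n_gt0.
have -> : (S1 F n)`_0 = transfer n 1 1 0.
  rewrite -Tpoly_horner scale0r horner_coef0 Tpoly1E [RHS]coefD coefZ coefXn.
  by rewrite eq_sym (gtn_eqF n_gt0) mulr0 add0r.
rewrite /transfer antisym1 vartheta_push rmorph1 mul1r.
have [s ->] : exists s, monodromy n 1 (0 : F) = sgen F s.
  apply: (big_ind (fun x => exists s, x = sgen F s)) => [|x y [s ->] [t ->]|j _].
  - by exists 1%g; rewrite sgen1.
  - by exists (t * s)%g; rewrite sgenM.
  by rewrite scale0r add0r /jucys big_ord1; eexists.
by rewrite Tr_lin_ext lin_ext_gen expr1n scale1r; eexists.
Qed.

(** * The commutative algebra generated by the coefficients of S_1 *)

Section GsumAlgebra.
Variables (F : numFieldType) (n : nat).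

Definition Gsum_alg : {aspace symalg F n} :=
  agenv_aspace <<[seq Gsum F n k | k <- iota 2 n.-1]>>%VS.

Lemma Gsum_coef k : (0 < k <= n)%N -> Gsum F n k = (S1 F n)`_(n - k).
Proof.
case/andP=> k_gt0 le_kn; have lt_k : (k.-1 < n)%N by rewrite prednK.
rewrite S1E coef_sum (bigD1 (Ordinal lt_k)) //= big1 => [|i ni]; last first.
  rewrite coefZ coefXn (_ : (_ == _) = false) ?mulr0 //.
  move: ni; rewrite -val_eqE /=; have := ltn_ord i; lia.
by rewrite prednK // coefZ coefXn eqxx mulr1 addr0.
Qed.

Lemma Gsum_comm k l : (0 < k <= n)%N -> (0 < l <= n)%N ->
  GRing.comm (Gsum F n k) (Gsum F n l).
Proof.
move=> kn ln; have := @Tpoly1_comm F n 0 (n - k) (n - l).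
by rewrite Tpoly1E scale0r scale0r add0r -!Gsum_coef.
Qed.

Lemma Gsum_alg1 : 1 \in Gsum_alg.
Proof. by rewrite memvE sub1_agenv. Qed.

Lemma Gsum_mem k : (0 < k <= n)%N -> Gsum F n k \in Gsum_alg.
Proof.
case: k => [//|[|k]] /andP[_ le_kn].
  by rewrite Gsum1 -[_%:R]scaler_nat memvZ // Gsum_alg1.
rewrite memvE; apply: subv_trans (sub_agenv _); rewrite -memvE.
by apply/memv_span/map_f; rewrite mem_iota; lia.
Qed.

Lemma Gsum_alg_comm : {in Gsum_alg &, commutative *%R}.
Proof.
set Gs := [seq Gsum F n k | k <- iota 2 n.-1].
have sub_cent y : {in Gs, forall g, g * y = y * g} -> (Gsum_alg <= 'C[y])%VS.
  move=> Gy; rewrite agenv_sub_modl //; first by rewrite -memvE cent1v1.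
  apply: prodv_sub => //; apply/span_subvP => g gG.
  by apply/cent1vP/Gy.
have GsP g : g \in Gs -> exists2 k, (0 < k <= n)%N & g = Gsum F n k.
  by case/mapP => k; rewrite mem_iota => k_in ->; exists k => //; lia.
have genC g : g \in Gs -> (Gsum_alg <= 'C[g])%VS.
  case/GsP => k kn ->; apply: sub_cent => _ /GsP[l ln ->].
  exact: Gsum_comm.
move=> x y xB yB; apply/cent1vP; move: x xB; apply/subvP/sub_cent => g gG.
by have /subvP/(_ y yB)/cent1vP-> := genC g gG.
Qed.

(** [Gsum_alg] as a commutative algebra in its own right, over which
    determinants are available. *)
Definition bethe_ring : Type := subvs_of Gsum_alg.
HB.instance Definition _ := Falgebra.on bethe_ring.
Fact bethe_ring_mulC : commutative (@GRing.mul bethe_ring).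
Proof. by move=> x y; apply/val_inj/Gsum_alg_comm; apply: subvsP. Qed.
HB.instance Definition _ := GRing.PzRing_hasCommutativeMul.Build bethe_ring bethe_ring_mulC.

Definition bethe_val (x : bethe_ring) : symalg F n := vsval x.
Fact bethe_val_linear : linear bethe_val.
Proof. by []. Qed.
HB.instance Definition _ :=
  GRing.isLinear.Build F bethe_ring (symalg F n) *:%R bethe_val bethe_val_linear.
Fact bethe_val_monoid : monoid_morphism bethe_val.
Proof.
by split=> //; apply/eqP; rewrite algid_eq1 Gsum_alg1.
Qed.
HB.instance Definition _ := GRing.isMonoidMorphism.Build bethe_ring (symalg F n) bethe_val bethe_val_monoid.

Lemma bethe_val_inj : injective bethe_val. Proof. exact: val_inj. Qed.

Definition lift_poly (P : {poly symalg F n}) : {poly bethe_ring} :=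
  \poly_(i < size P) (vsproj Gsum_alg P`_i : bethe_ring).

Definition coefs_in (P : {poly symalg F n}) := forall i, P`_i \in Gsum_alg.

Lemma lift_polyK P : coefs_in P -> map_poly bethe_val (lift_poly P) = P.
Proof.
move=> PB; apply/polyP => i; rewrite coef_map coef_poly /=.
case: ltnP => [_|le_i]; first exact: vsprojK.
by rewrite rmorph0 nth_default.
Qed.

Lemma coefs_inM P Q : coefs_in P -> coefs_in Q -> coefs_in (P * Q).
Proof. by move=> PB QB i; rewrite coefM rpred_sum // => j _; apply: memvM. Qed.

Lemma coefs_in_exp P i : coefs_in P -> coefs_in (P ^+ i).
Proof.
move=> PB; elim: i => [|i IHi]; last by rewrite exprS; apply: coefs_inM.
by move=> j; rewrite expr0 coef1; case: (j == 0%N); rewrite ?Gsum_alg1 ?mem0v.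
Qed.

Lemma coefs_in_Xsub1 : coefs_in ('X - 1).
Proof.
move=> i; rewrite coefB coefX coef1 rpredB //.
  by case: (_ == _); rewrite ?Gsum_alg1 ?mem0v.
by case: (_ == _); rewrite ?Gsum_alg1 ?mem0v.
Qed.

Lemma coefs_in_S1 : coefs_in (S1 F n).
Proof.
move=> i; rewrite S1E coef_sum rpred_sum // => j _; rewrite coefZ coefXn.
case: (_ == _); rewrite ?mulr1 ?mulr0 ?mem0v // Gsum_mem //.
exact: ltn_ord.
Qed.

Lemma coefs_in_comp P : coefs_in P -> coefs_in (P \Po ('X - 1)).
Proof.
move=> PB i; rewrite comp_polyE coef_sum rpred_sum // => j _.
by rewrite coefZ memvM //; apply/coefs_in_exp/coefs_in_Xsub1.
Qed.

Lemma coefs_in_series b : coefs_in (binom_series_opp (symalg F n) n b).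
Proof.
move=> i; rewrite coef_poly; case: ifP => _; last exact: mem0v.
rewrite rpredN rpredMn // -signr_odd.
by case: odd; rewrite ?expr1 ?rpredN Gsum_alg1.
Qed.

Lemma Tpoly_step (p : F) m :
  eqmodX n (('X - 1) ^+ n * Tpoly n m.+1 p) ((Tpoly n m p \Po ('X - 1)) * S1 F n).
Proof.
apply: (eqmodX_trans (@Tpoly_fusion F n p m)); apply: eqmodXM => // i lt_in.
by rewrite Tpoly1E coefD coefZ coefXn (ltn_eqF lt_in) mulr0 add0r.
Qed.

Lemma Tpoly_top_scalar p m : exists a : F, (Tpoly n m p)`_n = a%:A.
Proof.
elim: m => [|m [a IHm]]; first by exists 1; rewrite Tpoly_top0 scale1r.
exists (m.+1%:R^-1 * ((p - m%:R) * a)).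
rewrite -scalerA -[(_ * a)%:A]scalerA -IHm -Tpoly_top_rec scalerA mulVf ?scale1r //.
by rewrite pnatr_eq0.
Qed.

(** By the recursion, with (X - 1)^n inverted modulo X^n; the coefficient of X^n
    is a scalar. *)
Lemma coefs_in_Tpoly p m : coefs_in (Tpoly n m p).
Proof.
elim: m => [|m IHm].
  by move=> i; rewrite /Tpoly /= coefXn; case: (_ == _); rewrite ?Gsum_alg1 ?mem0v.
move=> i; case: (ltngtP i n) => [lt_in|lt_ni|->].
- pose s := binom_series_opp (symalg F n) n n.-1.
  have sD : eqmodX n (s * ('X - 1) ^+ n) 1.
    have commX : GRing.comm s ('X - 1).
      by apply: commrB; [apply: commr_polyX | apply: commr1].
    rewrite (commrX n commX) -[X in _ ^+ X](ltn_predK lt_in).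
    exact: binom_series_oppP.
  have -> : (Tpoly n m.+1 p)`_i = (s * ((Tpoly n m p \Po ('X - 1)) * S1 F n))`_i.
    have sT : eqmodX n (s * (('X - 1) ^+ n * Tpoly n m.+1 p)) (Tpoly n m.+1 p).
      by rewrite mulrA -[X in eqmodX _ _ X]mul1r; apply: eqmodXM.
    by rewrite -sT //; move: i lt_in; apply: eqmodXM => //; apply: Tpoly_step.
  apply: coefs_inM; first exact: coefs_in_series.
  by apply: coefs_inM; [apply: coefs_in_comp | apply: coefs_in_S1].
- by rewrite nth_default ?mem0v // (leq_trans (@size_Tpoly F n p m.+1)).
by have [a ->] := Tpoly_top_scalar p m.+1; rewrite memvZ ?Gsum_alg1.
Qed.
Theorem bethe_algE (p : F) : bethe_alg n p = Gsum_alg.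
Proof.
apply/eqP; rewrite eqEsubv; apply/andP; split.
  rewrite -[X in (_ <= X)%VS](agenv_id <<_>>) agenvS //; apply/span_subvP => x.
  by case/allpairsP => -[m i] [_ _ ->]; apply: coefs_in_Tpoly.
rewrite -[X in (_ <= X)%VS](agenv_id <<_>>) agenvS //; apply/span_subvP => x.
case/mapP => k; rewrite mem_iota => k_in ->.
rewrite memvE; apply: subv_trans (sub_agenv _); rewrite -memvE; apply/memv_span.
apply/allpairsP; exists (1%N, k); split; rewrite ?mem_iota /=; [lia|lia|].
rewrite /Tcoef Tpoly1E coefD coefZ coefXn (_ : (_ == _) = false); last by lia.
by rewrite mulr0 add0r Gsum_coef //; lia.
Qed.

Lemma Tpoly_top_p0 m : (Tpoly n m (0 : F))`_n = (m == 0%N)%:R.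
Proof.
elim: m => [|m IHm]; first exact: Tpoly_top0.
have := Tpoly_top_rec n (0 : F) m; rewrite {}IHm => e.
have : (Tpoly n m.+1 (0 : F))`_n = m.+1%:R^-1 *: ((0 - m%:R) *: (m == 0%N)%:R).
  by rewrite -e scalerA mulVf ?scale1r // pnatr_eq0.
by case: m {e} => [|m] ->; rewrite ?subrr ?scale0r ?scaler0.
Qed.

Lemma Tpoly_top_pn m : (Tpoly n m (n%:R : F))`_n = 'C(n, m)%:R.
Proof.
elim: m => [|m IHm]; first by rewrite Tpoly_top0 bin0.
have e := Tpoly_top_rec n (n%:R : F) m; rewrite {}IHm in e.
have -> : (Tpoly n m.+1 (n%:R : F))`_n = m.+1%:R^-1 *: ((n%:R - m%:R) *: 'C(n, m)%:R).
  by rewrite -e scalerA mulVf ?scale1r // pnatr_eq0.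
suff -> : (n%:R - m%:R) *: 'C(n, m)%:R = m.+1%:R *: 'C(n, m.+1)%:R :> symalg F n.
  by rewrite scalerA mulVf ?scale1r // pnatr_eq0.
rewrite [RHS]scaler_nat -mulrnA mulnC mul_bin_left.
have [le_mn|lt_nm] := leqP m n; last by rewrite bin_small // muln0 scaler0.
by rewrite -natrB // scaler_nat -mulrnA mulnC.
Qed.

Lemma Tpoly_sub_p0 m : (0 < n)%N -> (Tpoly n m.+1 (0 : F))`_n.-1 = (-1) ^+ m *+ n.
Proof.
move=> n_gt0; elim: m => [|m IHm].
  by rewrite Tpoly_sub_rec // Tpoly_top0 Tpoly_sub0 // subr0.
by rewrite Tpoly_sub_rec // IHm Tpoly_top_p0 mul0rn sub0r exprS mulN1r mulNrn.
Qed.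

Lemma lift_family (p : F) (t : nat -> nat) :
    (forall m, (Tpoly n m p)`_n = (t m)%:R) ->
  fusion_family n (lift_poly (S1 F n)) (fun m => (t m)%:R)
    (fun m => lift_poly (Tpoly n m p)).
Proof.
move=> topE; have coefK P i : coefs_in P -> bethe_val (lift_poly P)`_i = P`_i.
  move=> PB. have := coef_map bethe_val (lift_poly P) i. by rewrite lift_polyK.
split=> m.
- exact: leq_trans (size_poly _ _) (@size_Tpoly F n p m).
- by apply: bethe_val_inj; rewrite coefK ?topE ?rmorph_nat //; apply: coefs_in_Tpoly.
move=> i lt_in; apply: bethe_val_inj; rewrite -!(coef_map bethe_val).
rewrite !rmorphM rmorphXn rmorphB rmorph1 /= map_polyX map_comp_poly.
rewrite rmorphB rmorph1 /= map_polyX !lift_polyK;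
  by [apply: Tpoly_step | apply: coefs_in_S1 | apply: coefs_in_Tpoly].
Qed.

(** [Phat_fusion_family] is applied in [bethe_ring], to the lifts of S_1 and of
    the transfer matrices with p = 0 and with p = n. *)
Theorem Tuv_Phat : (0 < n)%N -> Tuv F n = Phat n (S1 F n).
Proof.
move=> n_gt0; have [t q0] := S1_coef0 F n_gt0.
pose q := lift_poly (S1 F n).
have q0E : bethe_val q`_0 = sgen F t.
  by rewrite -(coef_map bethe_val) lift_polyK //; apply: coefs_in_S1.
have rq : (q`_0)^-1 * q`_0 = 1.
  rewrite mulVr // vsval_unitr // -[vsval _]/(bethe_val _) q0E.
  by apply/unitrP; exists (sgen F t^-1%g); rewrite sgenVK sgenKV.
have val_inj : injective (map_poly bethe_val).
  exact: map_inj_poly bethe_val_inj (rmorph0 bethe_val).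
have XnE p : lift_poly (Tpoly n 0 p) = 'X^n.
  by apply: val_inj; rewrite lift_polyK ?map_polyXn //; apply: coefs_in_Tpoly.
have PE : Phat n q = \sum_(m < n.+1) ((-1) ^+ m * lift_poly (Tpoly n m n%:R))%:P * 'X^(n - m).
  have fam0 := lift_family (t := fun m => (m == 0%N)) Tpoly_top_p0.
  have famn := lift_family (t := fun m => 'C(n, m)) Tpoly_top_pn.
  have sub0 m : (lift_poly (Tpoly n m.+1 0))`_n.-1 = (-1) ^+ m *+ n.
    apply: bethe_val_inj; have := coef_map bethe_val (lift_poly (Tpoly n m.+1 0)) n.-1.
    rewrite lift_polyK; last exact: coefs_in_Tpoly.
    by rewrite Tpoly_sub_p0 // => <-; rewrite rmorphMn rmorph_sign.
  exact: (Phat_fusion_family n_gt0 rq fam0 (XnE 0) sub0 famn (XnE n%:R)).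
rewrite -(lift_polyK coefs_in_S1) -(Phat_map bethe_val) PE rmorph_sum; apply: eq_bigr => m _.
rewrite [RHS]rmorphM /= map_polyC map_polyXn /= [map_poly _ (_ * _)]rmorphM rmorph_sign /=.
rewrite lift_polyK //.
exact: coefs_in_Tpoly.
Qed.

End GsumAlgebra.

Theorem theorem8p3 (R : realType) (n : nat) (n_gt0 : (0 < n)%N) :
  (forall p : R[i],
     bethe_alg n p = agenv <<[seq Gsum R[i] n k | k <- iota 2 n.-1]>>%VS)
  /\ Tuv R[i] n = Phat n (S1 R[i] n).
Proof.
split=> [p|]; first exact: bethe_algE.
exact: Tuv_Phat.
Qed.
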